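(* Let $\gamma>1$ and $R>0$. Let $E$ be a Banach space and $x_0\in E$. Let $\varphi:B(x_0,R)\to E$ be an almost $\mathrm{Lip}-\gamma$ map and assume that $\mathrm{d}\varphi(x_0)$ is invertible. Then, for every $M_1>0$ and $M_2>0$ such that $\|\mathrm{d}\varphi\|_{\mathrm{Lip}-(\gamma-1)}\leq M_1$ and $\|\mathrm{d}\varphi(x_0)^{-1}\|\leq M_2$, there exists a constant $\delta>0$, depending only on $\gamma$ and $M_1M_2$, such that for every $\alpha$ with $\alpha<R$ and $0<\alpha\leq\delta$, setting $V_0=\varphi(x_0)+\mathrm{d}\varphi(x_0)(B(0,\alpha/2))$, the map $$\varphi:B(x_0,\alpha)\cap\varphi^{-1}(V_0)\to V_0$$ is an almost $\mathrm{Lip}-\gamma$ diffeomorphism, and $B(x_0,\alpha/3)\subseteq B(x_0,\alpha)\cap\varphi^{-1}(V_0)$. Moreover, the $\mathrm{Lip}-(\gamma-1)$ norm of $\mathrm{d}\varphi^{-1}$ (the derivative of the inverse map $\varphi^{-1}:V_0\to B(x_0,\alpha)\cap\varphi^{-1}(V_0)$) can be bounded from above by a constant depending only on $\gamma$, $M_1$ and $M_2$.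
   Context: Notation. $\mathbb{N}=\{0,1,2,\dots\}$, $\mathbb{N}^*=\mathbb{N}\setminus\{0\}$. $B(x,r)$ is the open ball. $E^{\otimes k}$ is the $k$-fold algebraic tensor power of $E$, with a fixed norm also denoted $\|\cdot\|$. $\mathcal{L}_s(E^{\otimes k},F)$ is the space of symmetric $k$-linear mappings from $E$ to $F$, seen as linear maps on $E^{\otimes k}$. Spaces of continuous linear maps carry the operator norm. Lipschitz maps. Let $n\in\mathbb{N}$, $0<\varepsilon\leq1$, $U\subseteq E$ any subset, $f^0:U\to F$ and $f^k:U\to\mathcal{L}_s(E^{\otimes k},F)$ for $1\leq k\leq n$. The remainder of order $k$ ($0\leq k\leq n$) of $f=(f^0,\dots,f^n)$ is defined by $$f^k(x)(v)=\sum_{j=k}^n f^j(y)\Big(\frac{v\otimes(x-y)^{\otimes(j-k)}}{(j-k)!}\Big)+R_k(x,y)(v),\quad x,y\in U,\ v\in E^{\otimes k}.$$ $f$ is $\mathrm{Lip}-(n+\varepsilon)$ on $U$ if there is $M$ such that for all $0\leq k\leq n$, $x,y\in U$, $v_1,\dots,v_k\in E$: $\|f^k(x)(v_1\otimes\cdots\otimes v_k)\|\leq M\|v_1\otimes\cdots\otimes v_k\|$ and $\|R_k(x,y)(v_1\otimes\cdots\otimes v_k)\|\leq M\|x-y\|^{n+\varepsilon-k}\|v_1\otimes\cdots\otimes v_k\|$. The smallest such $M$ is $\|f\|_{\mathrm{Lip}-(n+\varepsilon)}$. One often says that $f^0$ is Lip, the maps $f^1,\dots,f^n$ being understood; on open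 sets they are necessarily the successive derivatives of $f^0$. Almost Lipschitz maps. Let $n\in\mathbb{N}^*$, $0<\varepsilon\leq1$, $\delta\in(0,\infty]$. $f=(f^0,\dots,f^n)$ is almost Lipschitz of degree $n+\varepsilon$ on domains of size $\delta$ of $U$ if $(f^1,\dots,f^n)$ is $\mathrm{Lip}-(n+\varepsilon-1)$ (where $f^1$ takes values in $\mathcal{L}(E,F)$ and $f^{k+1}$ is identified with the order-$k$ component $(f^1)^k$ via $(f^1)^k(x)(v_1\otimes\cdots\otimes v_k)(v_{k+1})=f^{k+1}(x)(v_1\otimes\cdots\otimes v_{k+1})$) and there is $\tilde M\geq0$ with $\|R_0(x,y)\|\leq\tilde M\|x-y\|^{n+\varepsilon}$ for all $x,y\in U$ with $\|x-y\|<\delta$. When $\delta$ is infinite or its value is irrelevant (i.e. the property holds for some $\delta$), $f$ is simply called almost $\mathrm{Lip}-(n+\varepsilon)$ on $U$. On an open set such an $f$ is differentiable with $\mathrm{d}f=f^1$. Diffeomorphisms. A map $f:U\to V$ is an almost $\mathrm{Lip}-\gamma$ diffeomorphism if it is bijective and both $f$ and $f^{-1}$ are almost $\mathrm{Lip}-\gamma$. Standing assumption. The norms on tensor powers satisfy $\|v\otimes\tilde v\|=\|v\|\|\tilde v\|$ for all $k$, $v\in E^{\otimes k}$, $\tilde v\in E$; the projective property $\|a\otimes b\|\leq\|a\|\|b\|$ for $a\in E^{\otimes p}$, $b\in E^{\otimes q}$ (likewise for the tensor powers of the other spaces involved, such as $\mathcal{L}(E)$); compatibility ($\|u^{\otimes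 k}\|\leq\|u\|^k$ for bounded linear $u$); and symmetry ($\|\sigma(x)\|=\|x\|$ for permutations $\sigma$ of the tensor factors). *)

(* Defs.v *)
From HB Require Import structures.
From mathcomp Require Import all_boot all_order all_algebra all_fingroup.
From mathcomp Require Import all_classical all_reals all_analysis.
Set Implicit Arguments.
Unset Strict Implicit.
Unset Printing Implicit Defensive.
Import Order.TTheory GRing.Theory Num.Theory.
Import numFieldNormedType.Exports.
Local Open Scope classical_set_scope.
Local Open Scope ring_scope.

Section ContinuousLinearMaps.
Context {R : realType}.
Variables (E F : normedModType R).

Definition is_clin : {pred E -> F} := fun f => `[< linear f /\ continuous f >].

Lemma is_clin_submod : submod_closed is_clin.
Proof.
split.
  apply/asboolP; split; first by move=> a u v /=; rewrite scaler0 addr0.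
  by move=> x; exact: cvg_cst.
move=> a f g /asboolP[fl fc] /asboolP[gl gc]; apply/asboolP; split.
  move=> b u v; rewrite /= !fctE fl gl !scalerDr !scalerA (mulrC a b).
  by rewrite addrACA.
by move=> x; apply: cvgD; [apply: cvgZl_tmp; exact: fc|exact: gc].
Qed.

HB.instance Definition _ :=
  GRing.isSubmodClosed.Build R (E -> F)%type is_clin
    (GRing.submod_closed_semi is_clin_submod).

Record clin := Clin { clin_fun :> E -> F; _ : clin_fun \in is_clin }.

HB.instance Definition _ := [isSub for clin_fun].
HB.instance Definition _ := [Choice of clin by <:].
HB.instance Definition _ := [SubChoice_isSubLmodule of clin by <:].

Lemma clinP (f : clin) : linear f /\ continuous f.
Proof. by case: f => f /= /asboolP. Qed.

Definition opnorm (f : clin) : R :=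
  inf [set M | 0 <= M /\ forall x, `|f x| <= M * `|x|].

Let clin0 (f : clin) : f 0 = 0.
Proof.
have := (clinP f).1 1 0 0.
rewrite !scale1r !addr0 => /eqP.
by rewrite -[X in X == _]addr0 (inj_eq (addrI _)) eq_sym => /eqP.
Qed.

Let clinZ (f : clin) a x : f (a *: x) = a *: f x.
Proof. by have := (clinP f).1 a x 0; rewrite !addr0 clin0 addr0. Qed.

Let bnd0 (f : clin) : lbound [set M | 0 <= M /\ forall x, `|f x| <= M * `|x|] 0.
Proof. by move=> M []. Qed.

Let bndN0 (f : clin) : [set M | 0 <= M /\ forall x, `|f x| <= M * `|x|] !=set0.
Proof.
have [fl fc] := clinP f.
pose F0 : {linear E -> F} :=
  HB.pack (f : E -> F) (GRing.isLinear.Build R E F *:%R f fl).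
have /linear_boundedP [M [Mr H]] : bounded_near F0 (nbhs 0).
  by apply/linear_bounded_continuous.
exists (`|M| + 1); split => /=; first by rewrite addr_ge0.
by move=> x; apply: H; rewrite (le_lt_trans (ler_norm _))// ltrDl.
Qed.

Lemma opnorm_ge0 (f : clin) : 0 <= opnorm f.
Proof. by apply: lb_le_inf; [exact: bndN0|exact: bnd0]. Qed.

Lemma opnorm_le (f : clin) M :
  0 <= M -> (forall x, `|f x| <= M * `|x|) -> opnorm f <= M.
Proof. by move=> M0 H; apply: ge_inf; [exists 0; exact: bnd0|split]. Qed.

Lemma le_opnorm (f : clin) x : `|f x| <= opnorm f * `|x|.
Proof.
have [->|x0] := eqVneq x 0; first by rewrite clin0 !normr0 mulr0.
rewrite -ler_pdivrMr ?normr_gt0//; apply: lb_le_inf; first exact: bndN0.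
by move=> M [_ H]; rewrite ler_pdivrMr ?normr_gt0.
Qed.

Lemma opnormD (f g : clin) : opnorm (f + g) <= opnorm f + opnorm g.
Proof.
apply: opnorm_le; first by rewrite addr_ge0// opnorm_ge0.
move=> x; rewrite mulrDl.
by apply: le_trans (ler_normD _ _) _; rewrite lerD// le_opnorm.
Qed.

Let opnormZ_le a (f : clin) : opnorm (a *: f) <= `|a| * opnorm f.
Proof.
apply: opnorm_le; first by rewrite mulr_ge0// opnorm_ge0.
by move=> x; rewrite normrZ -mulrA ler_wpM2l// le_opnorm.
Qed.

Lemma opnormZ a (f : clin) : opnorm (a *: f) = `|a| * opnorm f.
Proof.
apply/eqP; rewrite eq_le opnormZ_le /=.
have [->|a0] := eqVneq a 0; first by rewrite normr0 mul0r opnorm_ge0.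
rewrite -ler_pdivlMl ?normr_gt0// -normfV.
by rewrite -{1}[f](scalerK a0) opnormZ_le.
Qed.

Lemma opnorm0_eq0 (f : clin) : opnorm f = 0 -> f = 0.
Proof.
move=> f0; apply/val_inj/funext => x; apply/eqP; rewrite -normr_le0.
by have := le_opnorm f x; rewrite f0 mul0r.
Qed.

HB.instance Definition _ :=
  Lmodule_isNormed.Build R clin opnormD opnormZ opnorm0_eq0.

Lemma clin_normE (f : clin) : `|f| = opnorm f.
Proof. by []. Qed.

End ContinuousLinearMaps.

Definition tset (T : Type) k (v : k.-tuple T) (i : 'I_k) (u : T) : k.-tuple T :=
  [tuple if j == i then u else tnth v j | j < k].

Definition tperm_act (T : Type) k (s : 'S_k) (v : k.-tuple T) : k.-tuple T :=
  [tuple tnth v (s i) | i < k].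

Definition multilinear {R : realType} {E F : lmodType R} k
    (g : k.-tuple E -> F) : Prop :=
  forall (v : k.-tuple E) (i : 'I_k), linear (fun u => g (tset v i u)).

Definition sym_multilinear {R : realType} {E F : lmodType R} k
    (g : k.-tuple E -> F) : Prop :=
  multilinear g /\ forall (s : 'S_k) v, g (tperm_act s v) = g v.

Section TensorPowers.
Context {R : realType}.

(** An element of the algebraic tensor power [E^{(x)k}] is represented by a
    formal sum of terms [a * (v_1 (x) ... (x) v_k)]; two formal sums represent
    the same tensor iff no k-linear map distinguishes them ([tequiv], i.e. the
    universal property). *)
Definition tensor (E : lmodType R) k := seq (R * k.-tuple E).

Definition tlift {E F : lmodType R} k (g : k.-tuple E -> F)
    (s : tensor E k) : F := \sum_(p <- s) p.1 *: g p.2.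

Definition tequiv {E : lmodType R} k (s t : tensor E k) : Prop :=
  forall (F : lmodType R) (g : k.-tuple E -> F),
    multilinear g -> tlift g s = tlift g t.

Definition tpure {E : lmodType R} k (v : k.-tuple E) : tensor E k := [:: (1, v)].

Definition tscale {E : lmodType R} k (a : R) (s : tensor E k) : tensor E k :=
  [seq (a * p.1, p.2) | p <- s].

Definition trcons {E : lmodType R} k (s : tensor E k) (u : E) : tensor E k.+1 :=
  [seq (p.1, rcons_tuple p.2 u) | p <- s].

Definition tmul {E : lmodType R} k l (s : tensor E k) (t : tensor E l) :
    tensor E (k + l) :=
  [seq (p.1 * q.1, cat_tuple p.2 q.2) | p <- s, q <- t].

Definition tmap {E F : lmodType R} k (h : E -> F) (s : tensor E k) :
    tensor F k :=
  [seq (p.1, map_tuple h p.2) | p <- s].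

Definition tperm_tensor {E : lmodType R} k (s : 'S_k) (t : tensor E k) :
    tensor E k :=
  [seq (p.1, tperm_act s p.2) | p <- t].

(** Families of norms on the tensor powers of [E]; [E^{(x)0}] is the field with
    its absolute value and [E^{(x)1}] is [E] with its own norm. *)
Record tensor_norm (E : normedModType R) (N : forall k, tensor E k -> R) :
    Prop := TensorNorm {
  tn_equiv : forall k (s t : tensor E k), tequiv s t -> N k s = N k t;
  tn_add : forall k (s t : tensor E k), N k (s ++ t) <= N k s + N k t;
  tn_scale : forall k a (s : tensor E k), N k (tscale a s) = `|a| * N k s;
  tn_eq0 : forall k (s : tensor E k), N k s = 0 -> tequiv s [::];
  tn_scalar : N 0 (tpure [tuple]) = 1;
  tn_vector : forall u : E, N 1 (tpure [tuple u]) = `|u|;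
  tn_cross : forall k (s : tensor E k) (u : E),
    N k.+1 (trcons s u) = N k s * `|u|;
  tn_projective : forall k l (s : tensor E k) (t : tensor E l),
    N (k + l)%N (tmul s t) <= N k s * N l t;
  tn_compat : forall k (h : clin E E) (s : tensor E k),
    N k (tmap h s) <= `|h| ^+ k * N k s;
  tn_sym : forall k (p : 'S_k) (s : tensor E k), N k (tperm_tensor p s) = N k s
}.

End TensorPowers.

(** [f k x] is the k-linear map [f^k(x)], evaluated on elementary tensors
    [v_1 (x) ... (x) v_k].  In all the notions below only the entries up to the
    relevant order, and the points [x] of the domain [U], matter. *)
Definition jet {R : realType} (E F : normedModType R) :=
  forall k, E -> k.-tuple E -> F.

Section Lipschitz.
Context {R : realType} {E : normedModType R}.
Variable N : forall k, tensor E k -> R.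

Definition jet0 {F : normedModType R} (f : jet E F) (x : E) : F :=
  f 0%N x [tuple].

(** The remainder [R_k(x,y)] of order [k] of [(f^0, ..., f^n)], for [k <= n];
    the summation index is [i = j - k]. *)
Definition remainder {F : normedModType R} n (f : jet E F) k (x y : E)
    (v : k.-tuple E) : F :=
  f k x v - \sum_(i < (n - k).+1)
    (i`!%:R)^-1 *: f (k + i)%N y [tuple of v ++ nseq i (x - y)].

Definition lip_bound {F : normedModType R} n (eps : R) (U : set E) (f : jet E F)
    (M : R) : Prop :=
  forall k, (k <= n)%N -> forall x y, U x -> U y -> forall v : k.-tuple E,
    `|f k x v| <= M * N (tpure v) /\
    `|remainder n f x y v|
      <= M * `|x - y| `^ (n%:R + eps - k%:R) * N (tpure v).

Definition lip {F : normedModType R} n (eps : R) (U : set E) (f : jet E F) :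
    Prop :=
  (forall k, (k <= n)%N -> forall x, U x -> sym_multilinear (f k x)) /\
  exists M, lip_bound n eps U f M.

Definition lip_norm {F : normedModType R} n (eps : R) (U : set E) (f : jet E F) :
    R :=
  inf [set M | lip_bound n eps U f M].

(** [f = (f^0, ..., f^(n+1))] is almost Lipschitz of degree [n + 1 + eps] on
    domains of size [delta] of [U], where [df] is [(f^1, ..., f^(n+1))] seen as
    a jet of order [n] with values in [L(E, F)]. *)
Definition almost_lip_size {F : normedModType R} n (eps : R) (delta : \bar R)
    (U : set E) (f : jet E F) (df : jet E (clin E F)) : Prop :=
  [/\ forall k, (k <= n.+1)%N -> forall x, U x -> sym_multilinear (f k x),
      forall k, (k <= n)%N -> forall x, U x -> forall (v : k.-tuple E) (u : E),
        df k x v u = f k.+1 x [tuple of rcons v u],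
      lip n eps U df &
      exists2 M : R, 0 <= M & forall x y, U x -> U y ->
        (`|x - y|%:E < delta)%E ->
        `|remainder n.+1 f x y [tuple]| <= M * `|x - y| `^ (n.+1%:R + eps)].

Definition almost_lip {F : normedModType R} n (eps : R) (U : set E)
    (f : jet E F) (df : jet E (clin E F)) : Prop :=
  exists2 delta : \bar R, (0 < delta)%E & almost_lip_size n eps delta U f df.

End Lipschitz.

(** [f] is an almost Lipschitz diffeomorphism of degree [n + 1 + eps] from [U]
    onto [V], with inverse [g]. *)
Definition almost_lip_diffeo {R : realType} {E : normedModType R}
    (N : forall k, tensor E k -> R) n (eps : R) (U V : set E)
    (f : jet E E) (df : jet E (clin E E)) (g : jet E E) (dg : jet E (clin E E)) :
    Prop :=
  [/\ set_bij U V (jet0 f),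
      forall x, U x -> jet0 g (jet0 f x) = x,
      almost_lip N n eps U f df &
      almost_lip N n eps V g dg].

(* Main.v *)
Require Import Defs.
From HB Require Import structures.
From mathcomp Require Import all_boot all_order all_algebra all_fingroup.
From mathcomp Require Import all_classical all_reals all_analysis.
From mathcomp Require Import ring lra zify.
Import Order.TTheory GRing.Theory Num.Theory.
Import numFieldNormedType.Exports.
Local Open Scope classical_set_scope.
Local Open Scope ring_scope.
Set Implicit Arguments.
Unset Strict Implicit.
Unset Printing Implicit Defensive.

(** After composing with [B := dphi(x0)^-1], [phi] is a [1/10]-Lipschitz
    perturbation of the identity on [B(x0, alpha)]: the Banach fixed point
    theorem yields the inverse [g], not only over [V0] but over the larger set
    [V1 := phi(x0) + dphi(x0)(B(0, 3 alpha/4))].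

    The derivatives of [g] are not obtained by differentiating the inverse.
    Integrating the order 1 remainder along segments bounds the order 0
    remainder of [phi] by [M1 |x - y|^gamma].  Inverting Taylor polynomials
    order by order then gives, at every point of [V1], a polynomial of degree
    [n + 1] approximating [g] up to [C |w|^gamma], where [C] only depends on
    [n], [eps], [M1] and [M2].  The remainder [R_k(x, y)] of [g] is the k-th
    coefficient of the difference [D] of the polynomials based at [x] and at
    [y], recentred at [x].  For [x], [y] in [V0], the ball of centre [x] and
    radius [|x - y| / (4 M1 M2)] is contained in [V1], so [D] is
    [O(|x - y|^gamma)] there, and a Markov-type inequality with polarization
    gives [R_k(x, y) = O(|x - y|^(gamma - k))]. *)

(** * Multilinear maps on sequences *)

Section Mlin.
Context {R : realType}.

(** A function on sequences stands for one map per order: its restriction to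
    the sequences of size [k] is the component of order [k]. *)
Definition mlin {E F : lmodType R} (q : seq E -> F) :=
  forall s1 s2, linear (fun u => q (s1 ++ u :: s2)).

Definition mbnd {E F : normedModType R} (C : R) (q : seq E -> F) :=
  forall s, `|q s| <= C * \prod_(u <- s) `|u|.

Lemma mlinD {E F : lmodType R} (q : seq E -> F) s1 s2 u v : mlin q ->
  q (s1 ++ (u + v) :: s2) = q (s1 ++ u :: s2) + q (s1 ++ v :: s2).
Proof. by move=> /(_ s1 s2 1 u v); rewrite !scale1r. Qed.

Lemma mlin0 {E F : lmodType R} (q : seq E -> F) s1 s2 : mlin q ->
  q (s1 ++ 0 :: s2) = 0.
Proof.
by move=> /(mlinD s1 s2 0 0)/eqP; rewrite addr0 -subr_eq0 opprD addNKr oppr_eq0 => /eqP.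
Qed.

Lemma mlinZ {E F : lmodType R} (q : seq E -> F) s1 s2 c u : mlin q ->
  q (s1 ++ (c *: u) :: s2) = c *: q (s1 ++ u :: s2).
Proof. by move=> ql; have := ql s1 s2 c u 0; rewrite !addr0 mlin0// addr0. Qed.

Lemma mlinB {E F : lmodType R} (q : seq E -> F) s1 s2 u v : mlin q ->
  q (s1 ++ (u - v) :: s2) = q (s1 ++ u :: s2) - q (s1 ++ v :: s2).
Proof. by move=> ql; rewrite mlinD// -scaleN1r mlinZ// scaleN1r. Qed.

Lemma mlin_sum {E F : lmodType R} (q : seq E -> F) s1 s2 I (r : seq I)
    (P : pred I) G : mlin q ->
  q (s1 ++ (\sum_(i <- r | P i) G i) :: s2) =
  \sum_(i <- r | P i) q (s1 ++ G i :: s2).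
Proof.
move=> ql; elim/big_rec2: _ => [|i y1 y2 _ <-]; first exact: mlin0.
exact: mlinD.
Qed.

Lemma mlin_cons {E F : lmodType R} (q : seq E -> F) x :
  mlin q -> mlin (fun s => q (x :: s)).
Proof. by move=> ql s1 s2; exact: (ql (x :: s1) s2). Qed.

Lemma mlin_lsum {E F : lmodType R} I (r : seq I) (P : pred I)
    (q : I -> seq E -> F) : (forall i, mlin (q i)) ->
  mlin (fun s => \sum_(i <- r | P i) q i s).
Proof.
move=> ql s1 s2 c u v /=; rewrite scaler_sumr -big_split/=.
by apply: eq_bigr => i _; rewrite (ql i).
Qed.

Lemma mlin_comp {E F G : lmodType R} (S : F -> G) (q : seq E -> F) :
  linear S -> mlin q -> mlin (S \o q).
Proof. by move=> Sl ql s1 s2 c u v /=; rewrite (ql s1) Sl. Qed.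

Lemma prod_norm_nseq {E : normedModType R} k (w : E) :
  \prod_(u <- nseq k w) `|u| = `|w| ^+ k.
Proof. by rewrite big_nseq iter_mulr_1. Qed.

Lemma mbnd_nseq {E F : normedModType R} C (q : seq E -> F) k w :
  mbnd C q -> `|q (nseq k w)| <= C * `|w| ^+ k.
Proof. by move=> /(_ (nseq k w)); rewrite prod_norm_nseq. Qed.

Lemma prod_norm_ge0 {E : normedModType R} (s : seq E) :
  0 <= \prod_(u <- s) `|u|.
Proof. by apply: prodr_ge0. Qed.

(** Telescoping: the copies of [h] are replaced by [h'] one at a time, the replaced ones being
    absorbed into the prefix [s]. *)
Lemma mlin_nseq_diff {E F : normedModType R} C m (q : seq E -> F) s j h h' :
  0 <= C -> mlin q -> mbnd C q -> `|h| <= m -> `|h'| <= m ->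
  `|q (s ++ nseq j h) - q (s ++ nseq j h')| <=
    C * (\prod_(u <- s) `|u|) * (j%:R * `|h - h'| * m ^+ j.-1).
Proof.
move=> C0 ql qb hm hm'; have m0 : 0 <= m by exact: le_trans hm.
elim: j s => [|j IH] s; first by rewrite subrr normr0 !mul0r mulr0.
have -> : q (s ++ nseq j.+1 h) - q (s ++ nseq j.+1 h') =
   q (s ++ (h - h') :: nseq j h) +
   (q (rcons s h' ++ nseq j h) - q (rcons s h' ++ nseq j h')).
  by rewrite mlinB// !cat_rcons addrA subrK.
apply: le_trans (ler_normD _ _) _.
apply: le_trans (lerD (qb _) (IH _)) _.
rewrite -cats1 !big_cat/= big_cons big_seq1 prod_norm_nseq.
set P := \prod_(u <- s) _; have P0 : 0 <= P by exact: prod_norm_ge0.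
have -> : C * P * (j.+1%:R * `|h - h'| * m ^+ j) =
  C * (P * (`|h - h'| * m ^+ j)) + C * P * (j%:R * `|h - h'| * m ^+ j).
  by rewrite -natr1; ring.
apply: lerD.
  do 3!(apply: ler_wpM2l => //); apply: lerXn2r; rewrite ?nnegrE//.
rewrite -!mulrA; do 2!(apply: ler_wpM2l => //).
case: j {IH} => [|j]; first by rewrite !mul0r !mulr0.
rewrite mulrCA; apply: ler_wpM2l => //.
rewrite mulrCA; apply: ler_wpM2l => //=.
by rewrite exprS; apply: ler_wpM2r => //; exact: exprn_ge0.
Qed.

(** The degree [size s] part of [a(Q,...,Q)] ([j] arguments), where [Q] is the
    polynomial with homogeneous parts [q] in degrees [1..d]. *)
Fixpoint jcomp {E F G : lmodType R} d (q : seq E -> F) j (a : seq F -> G)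
    (s : seq E) : G :=
  if j is j'.+1 then
    \sum_(k < d) if (k < size s)%N then
        jcomp d q j' (fun l => a (q (take k.+1 s) :: l)) (drop k.+1 s)
      else 0
  else if s is [::] then a [::] else 0.

Lemma jcomp_nil {E F G : lmodType R} d (q : seq E -> F) j (a : seq F -> G) :
  jcomp d q j.+1 a [::] = 0.
Proof. by rewrite /= big1. Qed.

Lemma jcomp_linear {E F G : lmodType R} d (q : seq E -> F) j c
    (a a1 a2 : seq F -> G) s : (forall l, a l = c *: a1 l + a2 l) ->
  jcomp d q j a s = c *: jcomp d q j a1 s + jcomp d q j a2 s.
Proof.
elim: j a a1 a2 s => [|j IH] a a1 a2 s H /=.
  by case: s => [|? ?]; rewrite ?H// scaler0 addr0.
rewrite scaler_sumr -big_split/=; apply: eq_bigr => k _.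
by case: ifP => _; [exact: IH|rewrite scaler0 addr0].
Qed.

(** The varying argument lies either in the first block, where linearity of [q] and [a] passes
    through [jcomp_linear], or in the rest, where induction applies to [a] with its first slot
    filled. *)
Lemma jcomp_mlin {E F G : lmodType R} d (q : seq E -> F) j (a : seq F -> G) :
  mlin q -> mlin a -> mlin (jcomp d q j a).
Proof.
move=> ql; elim: j a => [|j IH] a al s1 s2 c u v /=.
  by case: s1 => [|? ?] /=; rewrite scaler0 addr0.
rewrite scaler_sumr -big_split/=; apply: eq_bigr => k _.
rewrite !size_cat /=; case: ifP => _; last by rewrite scaler0 addr0.
have [ks|ks] := ltnP k (size s1).
  rewrite !take_cat !drop_cat.
  have [e|e] := ltnP k.+1 (size s1); first by apply: IH; exact: mlin_cons.
  have -> : (k.+1 - size s1 = 0)%N by lia.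
  by rewrite !take0 !cats0 !drop0; exact: (IH _ (mlin_cons (q s1) al) [::] s2 c u v).
rewrite !take_cat !drop_cat ltnNge (leqW ks)/=.
have -> : (k.+1 - size s1 = (k - size s1).+1)%N by lia.
rewrite /=; apply: jcomp_linear => l.
by rewrite (ql s1) (al [::] l).
Qed.

(** Each of the [j] nested sums has [d] terms, and each term costs a factor [Cq]; the norms over
    consecutive blocks multiply to the full product. *)
Lemma jcomp_bnd {E F G : normedModType R} d (q : seq E -> F) j
    (a : seq F -> G) Cq Ca : 0 <= Cq -> 0 <= Ca ->
  mbnd Cq q -> mbnd Ca a -> mbnd (Ca * (d%:R * Cq) ^+ j) (jcomp d q j a).
Proof.
move=> Cq0 + qb; elim: j a Ca => [|j IH] a Ca Ca0 ab s /=.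
  rewrite expr0 mulr1; case: s => [|x s]; first by have := ab [::]; rewrite !big_nil.
  by rewrite normr0 mulr_ge0// prod_norm_ge0.
apply: le_trans (ler_norm_sum _ _ _) _.
rewrite exprS.
have -> : Ca * (d%:R * Cq * (d%:R * Cq) ^+ j) * \prod_(u <- s) `|u| =
  \sum_(k < d) (Ca * Cq * (d%:R * Cq) ^+ j * \prod_(u <- s) `|u|).
  by rewrite sumr_const card_ord -mulr_natr; ring.
apply: ler_sum => k _; case: ifP => _; last first.
  by rewrite normr0 !mulr_ge0// ?exprn_ge0 ?mulr_ge0// prod_norm_ge0.
rewrite -{3}(cat_take_drop k.+1 s) big_cat/=.
have := IH (fun l => a (q (take k.+1 s) :: l))
  (Ca * (Cq * \prod_(u <- take k.+1 s) `|u|)).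
move/(_ _ _ (drop k.+1 s)).
set P := \prod_(_ <- _) _; have P0 : 0 <= P by exact: prod_norm_ge0.
set P' := \prod_(_ <- drop _ _) _; have P0' : 0 <= P' by exact: prod_norm_ge0.
set X := _ ^+ j => H; apply: le_trans (H _ _) _.
- by rewrite !mulr_ge0.
- move=> l; apply: le_trans (ab _) _; rewrite big_cons -!mulrA ler_wpM2l// mulrA.
  apply: ler_wpM2r; first exact: prod_norm_ge0.
  by apply: qb.
- by rewrite le_eqVlt; apply/orP; left; apply/eqP; ring.
Qed.

(** [a(Q, ..., Q)] has degree at most [j * d], so the parts of degree below [N] exhaust it. In the
    induction a first block of size [k + 1] leaves a sum over degrees shifted by [k + 1]. *)
Lemma jcomp_eval {E F G : lmodType R} d (q : seq E -> F) j (a : seq F -> G)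
    N w : mlin a -> (j * d < N)%N ->
  \sum_(K < N) jcomp d q j a (nseq K w) =
  a (nseq j (\sum_(k < d) q (nseq k.+1 w))).
Proof.
elim: j a N => [|j IH] a N al jN /=.
  case: N jN => // N _; rewrite big_ord_recl/= big1 ?addr0// => i _ /=.
rewrite exchange_big/= (mlin_sum [::] _ _ _ _ al)/=; apply: eq_bigr => k _.
have kN : (k.+1 <= N)%N by have := ltn_ord k; nia.
rewrite -[in RHS](IH (fun l => a (q (nseq k.+1 w) :: l)) (N - k.+1)%N); last 2 first.
- exact: mlin_cons.
- by have := ltn_ord k; rewrite mulSn in jN; lia.
rewrite -(big_mkord xpredT (fun K => if (k < size (nseq K w))%N then
  jcomp d q j (fun l => a (q (take k.+1 (nseq K w)) :: l))
    (drop k.+1 (nseq K w)) else 0)).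
rewrite (big_cat_nat _ kN)//= big_nat_cond big1 ?add0r; last first.
  by move=> i; rewrite size_nseq; case: ltnP => //; lia.
rewrite -{1}[k.+1]add0n big_addn big_mkord; apply: eq_bigr => i _.
rewrite size_nseq ifT; last by lia.
by rewrite take_nseq ?drop_nseq ?addnK//; lia.
Qed.

End Mlin.

Arguments jcomp : simpl never.

(** * Inversion of Taylor polynomials *)

Section Step.
Context {R : realType}.

Lemma powR_le_powR (x W s t : R) : 0 <= x -> x <= W -> 0 < t -> t <= s ->
  x `^ s <= W `^ (s - t) * x `^ t.
Proof.
move=> x0 xW t0 ts; have [->|xn0] := eqVneq x 0.
  rewrite powR0 ?mulr_ge0// ?powR_ge0//.
  by apply: lt0r_neq0; exact: lt_le_trans ts.
rewrite -[in leLHS](subrK t s) (@powRD _ x (s - t) t) ?xn0 ?implybT//.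
apply: ler_wpM2r; first exact: powR_ge0.
by apply: ge0_ler_powR; rewrite ?subr_ge0// nnegrE// (le_trans x0).
Qed.

Lemma exprn_le_powR (x W theta : R) k : 0 <= x -> x <= W -> 0 < theta ->
  theta <= k%:R -> x ^+ k <= W `^ (k%:R - theta) * x `^ theta.
Proof. by move=> x0; rewrite -powR_mulrn//; exact: powR_le_powR. Qed.

Lemma exprn_leD (x W : R) k i : 0 <= x -> x <= W ->
  x ^+ (k + i) <= W ^+ i * x ^+ k.
Proof.
move=> x0 xW; rewrite exprD mulrC ler_wpM2r// ?exprn_ge0//.
by apply: lerXn2r; rewrite ?nnegrE// (le_trans x0).
Qed.

Lemma linear_sumE {E F : lmodType R} (S : E -> F) I (r : seq I) (P : pred I) G :
  linear S -> S (\sum_(i <- r | P i) G i) = \sum_(i <- r | P i) S (G i).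
Proof.
move=> Sl; pose S' : {linear E -> F} :=
  HB.pack S (GRing.isLinear.Build R E F *:%R S Sl).
exact: (linear_sum S').
Qed.

Lemma linear_subE {E F : lmodType R} (S : E -> F) u v :
  linear S -> S (u - v) = S u - S v.
Proof.
move=> Sl; pose S' : {linear E -> F} :=
  HB.pack S (GRing.isLinear.Build R E F *:%R S Sl).
exact: (linearB S').
Qed.

Definition jvec {E : lmodType R} (s : seq E) : E :=
  if s is [:: u] then u else 0.

Lemma mlin_jvec {E : lmodType R} : mlin (@jvec E).
Proof.
move=> [|x s1] [|y s2] c u v //=; rewrite ?scaler0 ?addr0//.
  by rewrite /jvec/=; case: s1 => /= *; rewrite scaler0 addr0.
by rewrite /jvec/=; case: s1 => /= *; rewrite scaler0 addr0.
Qed.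

Lemma mbnd_jvec {E : normedModType R} : mbnd 1 (@jvec E).
Proof.
move=> [|x [|y s]]; rewrite mul1r /= ?normr0 ?prod_norm_ge0//.
by rewrite big_seq1.
Qed.

Lemma sum_jvec {E : lmodType R} d (w : E) :
  \sum_(k < d.+1) jvec (nseq k.+1 w) = w.
Proof. by rewrite big_ord_recl/= big1 ?addr0. Qed.

Lemma sum_ord_split (V : zmodType) (g : nat -> V) d N : g 0%N = 0 ->
  \sum_(K < d.+1 + N) g K = \sum_(k < d) g k.+1 + \sum_(i < N) g (d.+1 + i)%N.
Proof. by move=> g0; rewrite big_split_ord/= big_ord_recl/= g0 add0r. Qed.

(** The part of degree 0 vanishes, so the error consists of the parts of degree at least [d + 2];
    their excess degrees are paid with powers of [W]. *)
Lemma jcomp_trunc {E F G : normedModType R} d (q : seq E -> F) j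
    (a : seq F -> G) Cq Ca W w : 0 <= Cq -> 0 <= Ca -> 
  mlin a -> mbnd Cq q -> mbnd Ca a -> `|w| <= W ->
  `|a (nseq j.+2 (\sum_(k < d) q (nseq k.+1 w))) -
    \sum_(k < d.+1) jcomp d q j.+2 a (nseq k.+1 w)| <=
  (Ca * (d%:R * Cq) ^+ j.+2 * \sum_(i < (j.+2 * d).+1) W ^+ i) * `|w| ^+ d.+2.
Proof.
move=> Cq0 Ca0 al qb ab wW.
pose g K := jcomp d q j.+2 a (nseq K w).
have g0 : g 0%N = 0 by exact: jcomp_nil.
rewrite -(@jcomp_eval _ _ _ _ _ _ _ _ (d.+2 + (j.+2 * d).+1))//; last by lia.
have -> : \sum_(K < d.+2 + (j.+2 * d).+1) g K =
    \sum_(k < d.+1) g k.+1 + \sum_(i < (j.+2 * d).+1) g (d.+2 + i)%N.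
  exact: sum_ord_split.
rewrite addrAC subrr add0r.
apply: le_trans (ler_norm_sum _ _ _) _.
rewrite -mulrA mulr_suml mulr_sumr; apply: ler_sum => i _.
apply: le_trans (mbnd_nseq _ _ (jcomp_bnd _ _ Cq0 Ca0 qb ab)) _.
apply: ler_wpM2l; last exact: exprn_leD.
by rewrite mulr_ge0// exprn_ge0// mulr_ge0.
Qed.

(** [q'] is the part of degree at most [d + 1] of
    [S(w - sum_j a(Q(w), ..., Q(w)))]: since [j >= 2], an error of order [d + 1]
    on [Q] only has effects of order [d + 2]. *)
Lemma expansion_step m d (Ca CS C W theta : R) :
  0 <= Ca -> 0 <= CS -> 0 <= C -> 0 <= W -> 0 < theta -> theta <= d.+2%:R ->
  exists2 C' : R, 0 <= C' & forall (E : normedModType R) (a q : seq E -> E)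
    (S : E -> E),
  mlin a -> mbnd Ca a -> linear S -> (forall w, `|S w| <= CS * `|w|) ->
  mlin q -> mbnd C q ->
  exists q', [/\ mlin q', mbnd C' q' & forall w h,
    `|w| <= W -> `|h| <= C * `|w| ->
    `|h - \sum_(k < d) q (nseq k.+1 w)| <= C * `|w| ^+ d.+1 ->
    `|h - S (w - \sum_(j < m) a (nseq j.+2 h))| <= C * `|w| `^ theta ->
    `|h - \sum_(k < d.+1) q' (nseq k.+1 w)| <= C' * `|w| `^ theta].
Proof.
move=> Ca0 CS0 C0 W0 t0 td.
(* [K1] accounts for the discarded degrees, [K2] for replacing [h] by [Q(w)] inside [a]; [C1] bounds
   [q'] and [C2] its error. *)
pose K1 (j : nat) := Ca * (d%:R * C) ^+ j.+2 * \sum_(i < (j.+2 * d).+1) W ^+ i.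
pose K2 (j : nat) := Ca * (j.+2%:R * C * (C + C * W ^+ d) ^+ j.+1 * W ^+ j).
pose C1 := CS * (1 + \sum_(j < m) Ca * (d%:R * C) ^+ j.+2).
pose C2 := C + CS * ((\sum_(j < m) (K1 j + K2 j)) * W `^ (d.+2%:R - theta)).
have K10 j : 0 <= K1 j.
  apply: mulr_ge0; first by rewrite mulr_ge0// exprn_ge0// mulr_ge0.
  by apply: sumr_ge0 => i _; rewrite exprn_ge0.
have K20 j : 0 <= K2 j by rewrite !mulr_ge0// ?exprn_ge0 ?addr_ge0 ?mulr_ge0// exprn_ge0.
have C10 : 0 <= C1.
  rewrite mulr_ge0// addr_ge0// sumr_ge0// => i _.
  by rewrite mulr_ge0// exprn_ge0// mulr_ge0.
have C20 : 0 <= C2.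
  rewrite addr_ge0// mulr_ge0// mulr_ge0 ?powR_ge0//.
  by apply: sumr_ge0 => i _; rewrite addr_ge0.
exists (C1 + C2); first exact: addr_ge0.
move=> E a q S al ab Sl Sb ql qb.
(* [jvec] is the identity, seen as the component of order 1 of a jet. *)
pose b s := jvec s - \sum_(j < m) jcomp d q j.+2 a s.
have bl : mlin b.
  move=> s1 s2 c u v; rewrite /b mlin_jvec.
  rewrite (@mlin_lsum _ _ _ _ _ _ (fun j : 'I_m => jcomp d q j.+2 a))//.
    by rewrite scalerBr opprD addrACA.
  by move=> j; exact: jcomp_mlin.
have bb : mbnd (1 + \sum_(j < m) Ca * (d%:R * C) ^+ j.+2) b.
  move=> s; rewrite mulrDl mulr_suml.
  apply: le_trans (ler_normB _ _) _; apply: lerD; first exact: mbnd_jvec.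
  apply: le_trans (ler_norm_sum _ _ _) _; apply: ler_sum => j _.
  exact: jcomp_bnd.
exists (S \o b); split; first exact: mlin_comp.
  move=> s /=; apply: le_trans (Sb _) _.
  apply: le_trans (_ : _ <= C1 * \prod_(u <- s) `|u|) _.
    by rewrite -mulrA ler_wpM2l.
  by rewrite ler_wpM2r ?prod_norm_ge0// lerDl.
move=> w h wW hw hq hS; set Q := \sum_(k < d) _ in hq.
(* Adding and subtracting [a(Q, ..., Q)] separates the cost of replacing [h] by [Q] from the
   truncation error. *)
pose T := \sum_(j < m) (a (nseq j.+2 Q) - a (nseq j.+2 h) -
  (a (nseq j.+2 Q) - \sum_(k < d.+1) jcomp d q j.+2 a (nseq k.+1 w))).
have TE : T = \sum_(j < m) \sum_(k < d.+1) jcomp d q j.+2 a (nseq k.+1 w) -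
    \sum_(j < m) a (nseq j.+2 h).
  rewrite -sumrB; apply: eq_bigr => j _.
  by rewrite opprB addrC addrA subrK.
have -> : h - \sum_(k < d.+1) (S \o b) (nseq k.+1 w) =
    (h - S (w - \sum_(j < m) a (nseq j.+2 h))) + S T.
  rewrite -(linear_sumE _ _ (fun k : 'I_d.+1 => b (nseq k.+1 w)))//.
  rewrite /b sumrB sum_jvec exchange_big -addrA; congr (_ + _).
  apply: oppr_inj; rewrite opprK opprD opprK -linear_subE//; congr (S _).
  by rewrite TE opprB addrA subrK.
apply: le_trans (ler_normD _ _) _.
apply: le_trans (_ : _ <= C2 * `|w| `^ theta) _; last first.
  by rewrite ler_wpM2r ?powR_ge0// lerDr.
rewrite /C2 mulrDl; apply: lerD => //.
apply: le_trans (Sb _) _; rewrite -mulrA ler_wpM2l//.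
apply: le_trans (ler_norm_sum _ _ _) _; rewrite 2!mulr_suml; apply: ler_sum => j _.
have WT : `|w| ^+ d.+2 <= W `^ (d.+2%:R - theta) * `|w| `^ theta.
  exact: exprn_le_powR.
rewrite -mulrA; apply: le_trans (_ : _ <= (K1 j + K2 j) * `|w| ^+ d.+2) _; last first.
  by apply: ler_wpM2l => //; exact: addr_ge0.
apply: le_trans (ler_normB _ _) _; rewrite addrC mulrDl; apply: lerD.
  exact: jcomp_trunc.
have hm : `|h| <= (C + C * W ^+ d) * `|w|.
  by apply: le_trans hw _; rewrite ler_wpM2r// lerDl mulr_ge0// exprn_ge0.
have Qm : `|Q| <= (C + C * W ^+ d) * `|w|.
  rewrite -(subrK h Q) addrC; apply: le_trans (ler_normD _ _) _.
  rewrite mulrDl; apply: lerD => //; rewrite distrC; apply: le_trans hq _.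
  by rewrite -mulrA ler_wpM2l// -(add1n d) exprn_leD.
have := mlin_nseq_diff [::] j.+2 Ca0 al ab Qm hm.
rewrite big_nil mulr1 => /le_trans; apply.
rewrite /K2 -!mulrA ler_wpM2l//.
rewrite ler_wpM2l// distrC.
rewrite exprMn.
have -> : C * ((C + C * W ^+ d) ^+ j.+1 * (W ^+ j * `|w| ^+ d.+2)) =
  (C * ((C + C * W ^+ d) ^+ j.+1)) * (W ^+ j * `|w| ^+ d.+2) by ring.
apply: le_trans (_ : _ <= (C * `|w| ^+ d.+1) *
  ((C + C * W ^+ d) ^+ j.+1 * `|w| ^+ j.+1)) _.
  apply: ler_wpM2r => //.
  by rewrite mulr_ge0// exprn_ge0// addr_ge0// mulr_ge0// exprn_ge0.
have -> : C * `|w| ^+ d.+1 * ((C + C * W ^+ d) ^+ j.+1 * `|w| ^+ j.+1) =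
  C * (C + C * W ^+ d) ^+ j.+1 * `|w| ^+ (d.+2 + j).
  by rewrite !exprD !exprS; ring.
apply: ler_wpM2l; last exact: exprn_leD.
by rewrite mulr_ge0// exprn_ge0// addr_ge0// mulr_ge0// exprn_ge0.
Qed.

(** Starting from the zero polynomial, each step gains one order, up to the exponent [m + 1]; a last
    step reaches [theta]. Since [q] depends on [a] and [S] alone, one polynomial serves all pairs
    [w], [h]. *)
Lemma expansion_exists m (theta Ca CS C W : R) : 
  0 <= Ca -> 0 <= CS -> 0 <= C -> 0 <= W ->
  m.+1%:R < theta -> theta <= m.+2%:R ->
  exists2 C' : R, 0 <= C' & forall (E : normedModType R) (a : seq E -> E)
    (S : E -> E),
  mlin a -> mbnd Ca a -> linear S -> (forall w, `|S w| <= CS * `|w|) ->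
  exists q, [/\ mlin q, mbnd C' q & forall w h,
    `|w| <= W -> `|h| <= C * `|w| ->
    `|h - S (w - \sum_(j < m) a (nseq j.+2 h))| <= C * `|w| `^ theta ->
    `|h - \sum_(k < m.+1) q (nseq k.+1 w)| <= C' * `|w| `^ theta].
Proof.
move=> Ca0 CS0 C0 W0 mt tm.
have : forall d, (d <= m)%N -> exists2 C' : R, C <= C' &
  forall (E : normedModType R) (a : seq E -> E) (S : E -> E),
  mlin a -> mbnd Ca a -> linear S -> (forall w, `|S w| <= CS * `|w|) ->
  exists q, [/\ mlin q, mbnd C' q & forall w h,
    `|w| <= W -> `|h| <= C * `|w| ->
    `|h - S (w - \sum_(j < m) a (nseq j.+2 h))| <= C * `|w| `^ theta ->
    `|h - \sum_(k < d) q (nseq k.+1 w)| <= C' * `|w| ^+ d.+1].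
  elim=> [_|d IH dm].
    exists C => // E a S al ab Sl Sb; exists (fun=> 0); split.
    - by move=> s1 s2 c u v; rewrite scaler0 addr0.
    - by move=> s; rewrite normr0 mulr_ge0// prod_norm_ge0.
    - by move=> w h wW hw _; rewrite big_ord0 subr0 expr1.
  have [C1 CC1 {}IH] := IH (ltnW dm).
  have C10 : 0 <= C1 by exact: le_trans CC1.
  (* Dominates [C1] as well as the constant of the equation for [h] once its exponent [theta] is
     weakened to [d + 2], which costs a power of [W]. *)
  pose D := C1 + C * W `^ (theta - d.+2%:R).
  have D0 : 0 <= D by rewrite addr_ge0// mulr_ge0// powR_ge0.
  have [||C2 C20 step] := @expansion_step m d Ca CS D W d.+2%:R Ca0 CS0 D0 W0.
  - by [].
  - by [].
  exists (C + C2); first by rewrite lerDl.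
  move=> E a S al ab Sl Sb.
  have [q [ql qb qE]] := IH _ _ _ al ab Sl Sb.
  have C1D : C1 <= D by rewrite lerDl mulr_ge0// powR_ge0.
  have qD : mbnd D q.
    by move=> s; apply: le_trans (qb _) _; rewrite ler_wpM2r ?prod_norm_ge0.
  have [q' [q'l q'b q'E]] := step _ _ q _ al ab Sl Sb ql qD.
  exists q'; split => //.
    by move=> s; apply: le_trans (q'b _) _; rewrite ler_wpM2r ?prod_norm_ge0 ?lerDr.
  move=> w h wW hw hS; rewrite -powR_mulrn//.
  apply: le_trans (q'E w h wW _ _ _) _.
  - by apply: le_trans hw _; rewrite ler_wpM2r// (le_trans CC1).
  - by apply: le_trans (qE _ _ wW hw hS) _; rewrite ler_wpM2r// exprn_ge0.
  - apply: le_trans hS _.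
    apply: le_trans (_ : _ <= C * W `^ (theta - d.+2%:R) * `|w| `^ d.+2%:R) _.
      rewrite -mulrA ler_wpM2l// powR_le_powR//.
      by apply: ltW; apply: le_lt_trans mt; rewrite ler_nat.
    by rewrite ler_wpM2r ?powR_ge0// lerDr.
  by rewrite ler_wpM2r ?powR_ge0// lerDr.
move=> /(_ m (leqnn m))[C1 CC1 IH].
have C10 : 0 <= C1 by exact: le_trans CC1.
have [||C2 C20 step] := @expansion_step m m Ca CS C1 W theta Ca0 CS0 C10 W0.
- by apply: le_lt_trans mt.
- by [].
exists C2 => // E a S al ab Sl Sb.
have [q [ql qb qE]] := IH _ _ _ al ab Sl Sb.
have [q' [q'l q'b q'E]] := step _ _ q _ al ab Sl Sb ql qb.
exists q'; split => // w h wW hw hS.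
apply: q'E => //.
- by apply: le_trans hw _; rewrite ler_wpM2r.
- exact: qE.
- by apply: le_trans hS _; rewrite ler_wpM2r// powR_ge0.
Qed.

End Step.

(** * From polynomials to their coefficients *)

Section Markov.
Context {R : realType}.

(** The top coefficient of [p(t)] is eliminated by [p(t) - 2^N p(t/2)]. *)
Lemma poly_coef_bound N : exists2 K : R, 0 <= K &
  forall (F : normedModType R) (c : nat -> F) B,
  (forall t : R, 0 <= t -> t <= 1 -> `|\sum_(m < N.+1) t ^+ m *: c m| <= B) ->
  forall m, (m <= N)%N -> `|c m| <= K * B.
Proof.
elim: N => [|N [K K0 IH]].
  exists 1 => // F c B /(_ 0 (lexx _) ler01); rewrite big_ord1 expr0 scale1r.
  by move=> H [|m]// _; rewrite mul1r.
pose K1 := K * (1 + 2 ^+ N.+1).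
have K10 : 0 <= K1 by rewrite mulr_ge0// addr_ge0// exprn_ge0.
exists (1 + N.+2%:R * K1); first by rewrite addr_ge0// mulr_ge0.
move=> F c B H.
have B0 : 0 <= B by apply: le_trans (H 0 _ _); rewrite ?normr_ge0.
have cN m : (m <= N)%N -> `|c m| <= K1 * B.
  (* The coefficients of [p(t) - 2^(N+1) p(t/2)]; for [m <= N] the factor of [c m] has absolute
     value at least 1. *)
  move=> mN; pose c' m := (1 - 2 ^+ (N.+1 - m)) *: c m : F.
  apply: le_trans (_ : _ <= `|c' m|) _.
    rewrite normrZ ler_peMl// distrC ger0_norm.
      rewrite lerBrDr (le_trans (_ : _ <= 2 ^+ 1))//.
      by rewrite ler_eXn2l ?ltr1n//; lia.
    by rewrite subr_ge0 exprn_ege1// ler1n.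
  rewrite -mulrA; apply: (IH F c' _ _ _ mN) => t t0 t1.
  have -> : \sum_(m < N.+1) t ^+ m *: c' m =
      \sum_(m < N.+2) t ^+ m *: c m -
      2 ^+ N.+1 *: \sum_(m < N.+2) (t / 2) ^+ m *: c m.
    rewrite scaler_sumr -sumrB [RHS]big_ord_recr/= !scalerA exprMn mulrCA.
    rewrite -exprMn mulfV// expr1n mulr1 subrr addr0.
    apply: eq_bigr => i _; rewrite /c' !scalerA -scalerBl; congr (_ *: _).
    rewrite mulrBr mulr1 exprMn mulrCA; congr (_ - _ * _).
    have iN : (i <= N.+1)%N by have := ltn_ord i; lia.
    have e2 : (2 : R) ^+ i != 0 by rewrite expf_neq0.
    by apply: (mulIf e2); rewrite -exprD subnK// exprVn divfK.
  apply: le_trans (ler_normB _ _) _; rewrite mulrDl mul1r; apply: lerD.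
    exact: H.
  rewrite normrZ ger0_norm ?exprn_ge0// ler_wpM2l ?exprn_ge0//.
  by apply: H; lra.
clearbody K1; move=> m; rewrite leq_eqVlt => /orP[/eqP ->|mN]; last first.
  apply: le_trans (cN _ mN) _; rewrite mulrDl mul1r -[leLHS]add0r -mulrA lerD//.
  by rewrite ler_peMl ?mulr_ge0// ler1n.
have := H 1 ler01 (lexx _); rewrite big_ord_recr/= expr1n scale1r => H1.
set X := \sum_(i < N.+1) _ in H1.
have -> : c N.+1 = X + c N.+1 - X by rewrite addrC addKr.
apply: le_trans (ler_normB _ _) _; rewrite mulrDl mul1r; apply: lerD => //.
apply: le_trans (ler_norm_sum _ _ _) _.
apply: le_trans (_ : _ <= \sum_(i < N.+1) K1 * B) _.
  apply: ler_sum => i _; rewrite expr1n scale1r cN//.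
  by have := ltn_ord i; lia.
rewrite sumr_const card_ord -[leLHS]mulr_natl mulrA.
by do 2!(apply: ler_wpM2r => //); rewrite ler_nat.
Qed.

Definition perm_invariant (E : eqType) (F : Type) (p : seq E -> F) :=
  forall s t, perm_eq s t -> p s = p t.

Lemma perm_invariant_cons (E : eqType) F (p : seq E -> F) v :
  perm_invariant p -> perm_invariant (fun s => p (v :: s)).
Proof. by move=> pp s t st; apply: pp; rewrite perm_cons. Qed.

(** Pascal's rule: expanding the first [u + v] moves [u] or [v] into the prefix, and symmetry puts
    the arguments back in order. *)
Lemma mlin_binom {E F : lmodType R} (p : seq E -> F) s r u v :
  mlin p -> perm_invariant p ->
  p (s ++ nseq r (u + v)) =
  \sum_(k < r.+1) 'C(r, k)%:R *: p (s ++ nseq k u ++ nseq (r - k) v).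
Proof.
move=> pl pp; elim: r s => [|r IH] s.
  by rewrite big_ord1 bin0 scale1r.
rewrite [nseq r.+1 _]/= mlinD// -!cat_rcons !IH.
pose g k l := p (s ++ nseq k u ++ nseq l v).
rewrite (eq_bigr (fun k : 'I_r.+1 => 'C(r, k)%:R *: g k.+1 (r - k)%N)); last first.
  by move=> k _; rewrite cat_rcons.
rewrite [X in _ + X](eq_bigr (fun k : 'I_r.+1 => 'C(r, k)%:R *: g k (r.+1 - k)%N));
  last first.
  move=> k _; congr (_ *: _); apply: pp; rewrite cat_rcons perm_cat2l.
  rewrite subSn; last by rewrite -ltnS.
  by rewrite -(cat1s v (nseq k u ++ _)) perm_catCA.
rewrite [RHS](eq_bigr (fun k : 'I_r.+2 => 'C(r.+1, k)%:R *: g k (r.+1 - k)%N))//.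
rewrite [RHS]big_ord_recl bin0 scale1r subn0.
under [in RHS]eq_bigr do rewrite lift0 binS natrD scalerDl.
rewrite [in RHS]big_split/= [X in _ = _ + (X + _)]big_ord_recr/=.
rewrite bin_small// scale0r addr0.
rewrite [X in _ + X = _]big_ord_recl bin0 scale1r subn0 addrC -addrA.
by congr (_ + (_ + _)); apply: eq_bigr => i _; rewrite subSS.
Qed.

(** Recentring of a Taylor polynomial. Raising [N] by one adds a term to each inner sum; with the
    new outer term these form the binomial expansion of the part of degree [N + 1]. *)
Lemma taylor_shift {E F : lmodType R} (p : seq E -> F) N u v :
  mlin p -> perm_invariant p ->
  \sum_(j < N.+1) (j`!%:R)^-1 *: p (nseq j (u + v)) =
  \sum_(k < N.+1) (k`!%:R)^-1 *:
     \sum_(i < (N - k).+1) (i`!%:R)^-1 *: p (nseq k u ++ nseq i v).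
Proof.
move=> pl pp; elim: N => [|N IH].
  by rewrite !big_ord1 /= fact0 invr1 !scale1r.
rewrite big_ord_recr/= {}IH [RHS]big_ord_recr/= subnn big_ord1 fact0 invr1 scale1r cats0.
under [X in _ = X + _]eq_bigr => k _.
  rewrite subSn; last by rewrite -ltnS.
  rewrite big_ord_recr/= scalerDr.
  over.
rewrite big_split/= -addrA; congr (_ + _).
have := mlin_binom [::] N.+1 u v pl pp; rewrite !cat0s => ->.
rewrite scaler_sumr big_ord_recr/= binn subnn cats0 scale1r; congr (_ + _).
apply: eq_bigr => k _.
have kN1 : (N.+1 - k = (N - k).+1)%N by rewrite subSn// -ltnS.
rewrite !scalerA kN1; congr (_ *: _).
have kN : (k <= N.+1)%N by have := ltn_ord k; lia.
rewrite -kN1 -(bin_fact kN) !natrM.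
by field; rewrite !pnatr_eq0 -!lt0n !fact_gt0 bin_gt0.
Qed.

Lemma mlin_scale_nseq {E F : lmodType R} (p : seq E -> F) s1 s2 m t v :
  mlin p -> p (s1 ++ nseq m (t *: v) ++ s2) = t ^+ m *: p (s1 ++ nseq m v ++ s2).
Proof.
move=> pl; elim: m s1 => [|m IH] s1; first by rewrite scale1r.
rewrite /= mlinZ// -cat_rcons IH scalerA -exprS cat_rcons.
by [].
Qed.

(** The coefficient of [t] in [p((u + t v)^k)] is [k p(v, u, ..., u)], which
    frees one argument at a time. *)
Lemma polarization k : exists2 K : R, 0 <= K & forall (E F : normedModType R)
  (p : seq E -> F) rho B, mlin p -> perm_invariant p -> 0 <= rho ->
  (forall u, `|u| <= rho -> `|p (nseq k u)| <= B) ->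
  forall s, size s = k -> (forall u, u \in s -> `|u| <= rho / 2 ^+ k) ->
  `|p s| <= K * B.
Proof.
elim: k => [|k [K K0 IH]].
  exists 1 => // E F p rho B _ _ r0 H [|//] _ _; rewrite mul1r.
  by apply: (H 0); rewrite normr0.
have [K1 K10 HK1] := poly_coef_bound k.+1.
exists (K * K1); first exact: mulr_ge0.
move=> E F p rho B pl pp r0 H [//|v s] [sk] sr; rewrite -mulrA.
(* Freeing one argument halves the radius, so that [t v + u] stays in the ball of radius [rho];
   hence the [2 ^ k] of the statement. *)
have r20 : 0 <= rho / 2 by lra.
have r2k : rho / 2 ^+ k.+1 <= rho / 2.
  rewrite ler_wpM2l// lef_pV2 ?posrE ?exprn_gt0//.
  by rewrite exprS ler_peMr// exprn_ege1// ler1n.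
have vr : `|v| <= rho / 2 by apply: le_trans r2k; rewrite sr// mem_head.
apply: (IH E F (fun s => p (v :: s)) (rho / 2) _ (mlin_cons v pl)
  (perm_invariant_cons v pp)) => //; last first.
  by move=> u us; rewrite -mulrA -invfM -exprS sr// in_cons us orbT.
move=> u ur.
pose c m := 'C(k.+1, m)%:R *: p (nseq m v ++ nseq (k.+1 - m) u).
have := HK1 F c B; move=> /(_ _ 1%N isT); rewrite /c bin1 subSS subn0 => HB.
apply: le_trans (HB _); first by rewrite normrZ normr_nat ler_peMl// ler1n.
move=> t t0 t1; apply: le_trans (_ : _ <= `|p (nseq k.+1 (t *: v + u))|) _.
  rewrite -[nseq _ _]cat0s mlin_binom// le_eqVlt; apply/orP; left; apply/eqP.
  congr `|_|; apply: eq_bigr => m _.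
  by rewrite /c mlin_scale_nseq// !scalerA mulrC.
apply: H; apply: le_trans (ler_normD _ _) _; rewrite normrZ ger0_norm//.
have : t * `|v| <= 1 * `|v| by rewrite ler_wpM2r.
by move: vr ur; lra.
Qed.

(** Nonzero arguments are rescaled to norm [r] one at a time; a vanishing argument makes [p s]
    vanish. *)
Lemma mlin_homogeneous_bound {E F : normedModType R} (p : seq E -> F) r B k :
  mlin p -> 0 < r -> 
  (forall s, size s = k -> (forall u, u \in s -> `|u| <= r) -> `|p s| <= B) ->
  forall s, size s = k -> `|p s| <= B / r ^+ k * \prod_(u <- s) `|u|.
Proof.
move=> + r0; elim: k p B => [|k IH] p B pl H s.
  by move/size0nil => ->; rewrite big_nil expr0 invr1 !mulr1 H.
have B0 : 0 <= B.
  apply: le_trans (H (nseq k.+1 0) _ _); rewrite ?normr_ge0 ?size_nseq//.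
  by move=> u; rewrite mem_nseq => /andP[_ /eqP ->]; rewrite normr0 ltW.
case: s => [//|v s] [sk]; have [->|v0] := eqVneq v 0.
  by rewrite (mlin0 [::])// normr0 mulr_ge0 ?prod_norm_ge0// divr_ge0// exprn_ge0 ?ltW.
pose v' := (r / `|v|) *: v.
have nv0 : `|v| != 0 by rewrite normr_eq0.
have -> : v = (`|v| / r) *: v'.
  by rewrite scalerA mulrA divfK ?gt_eqF// mulfV// scale1r.
have v'r : `|v'| = r by rewrite normrZ normrM normfV normr_id divfK// gtr0_norm.
clearbody v'; rewrite (mlinZ [::])// normrZ big_cons [in leRHS]normrZ.
rewrite v'r normrM normfV normr_id (gtr0_norm r0).
have vr0 : 0 <= `|v| / r by rewrite divr_ge0// ltW.
have Hv' t : size t = k -> (forall u, u \in t -> `|u| <= r) ->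
    `|p (v' :: t)| <= B.
  move=> tk tr; apply: H; rewrite /= ?tk// => u.
  by rewrite inE => /orP[/eqP ->|/tr//]; rewrite v'r.
have := IH (fun s => p (v' :: s)) B (mlin_cons v' pl) Hv' s sk.
move=> /(ler_wpM2l vr0)/le_trans; apply.
rewrite exprS invfM le_eqVlt; apply/orP; left; apply/eqP; field.
by rewrite ?expf_neq0 gt_eqF.
Qed.

(** Markov-type inequality: the homogeneous parts at [u] are coefficients in [t] of the polynomial
    at [t u]; polarization then leaves the diagonal, and rescaling frees the norms of the
    arguments. *)
Lemma jet_coef_bound N : exists2 K : R, 0 <= K & forall (E F : normedModType R)
  (p : seq E -> F) rho B, mlin p -> perm_invariant p -> 0 < rho ->
  (forall w, `|w| <= rho ->
     `|\sum_(k < N.+1) (k`!%:R)^-1 *: p (nseq k w)| <= B) ->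
  forall s, (size s <= N)%N ->
  `|p s| <= K * B / rho ^+ size s * \prod_(u <- s) `|u|.
Proof.
have [K0 K00 HK0] := poly_coef_bound N.
have /choice[Kp HKp] : forall k, exists K : R, 0 <= K /\
  forall (E F : normedModType R)
  (p : seq E -> F) rho B, mlin p -> perm_invariant p -> 0 <= rho ->
  (forall u, `|u| <= rho -> `|p (nseq k u)| <= B) ->
  forall s, size s = k -> (forall u, u \in s -> `|u| <= rho / 2 ^+ k) ->
  `|p s| <= K * B.
  by move=> k; have [K ? ?] := polarization k; exists K.
have Kp0 k : 0 <= Kp k by have [] := HKp k.
(* [k!] and [K0] come from extracting the part of degree [k], [Kp k] from polarization, and
   [(2 ^ k) ^ k] from the reduced radius [rho / 2 ^ k]. *)
pose T k := Kp k * k`!%:R * K0 * (2 ^+ k) ^+ k.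
have T0 k : 0 <= T k by rewrite mulr_ge0 ?exprn_ge0// !mulr_ge0.
exists (\sum_(k < N.+1) T k); first by rewrite sumr_ge0.
move=> E F p rho B pl pp r0 H s sN.
have B0 : 0 <= B by apply: le_trans (normr_ge0 _) (H 0 _); rewrite normr0 ltW.
apply: le_trans (_ : _ <= T (size s) * B / rho ^+ size s * \prod_(u <- s) `|u|) _.
  set k := size s in sN *.
  have diag u : `|u| <= rho -> `|p (nseq k u)| <= k`!%:R * K0 * B.
    move=> ur; have := HK0 F (fun m => (m`!%:R)^-1 *: p (nseq m u)) B _ k sN.
    rewrite normrZ normfV normr_nat ler_pdivrMl ?ltr0n ?fact_gt0// mulrA; apply.
    move=> t t0 t1; have := H (t *: u); rewrite normrZ ger0_norm// => /(_ _).
    have -> : \sum_(m < N.+1) t ^+ m *: ((m`!%:R)^-1 *: p (nseq m u)) =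
      \sum_(k < N.+1) (k`!%:R)^-1 *: p (nseq k (t *: u)).
      apply: eq_bigr => i _; have := mlin_scale_nseq [::] [::] i t u pl.
      by rewrite !cats0 /= => ->; rewrite !scalerA mulrC.
    by apply; apply: le_trans ur; rewrite ler_piMl.
  have := mlin_homogeneous_bound pl _ ((HKp k).2 E F p rho _ pl pp (ltW r0) diag) (erefl k).
  move=> /(_ _)/le_trans; apply; first by rewrite divr_gt0// exprn_gt0.
  rewrite ler_wpM2r ?prod_norm_ge0// /T le_eqVlt; apply/orP; left; apply/eqP.
  rewrite -/k expr_div_n; field.
  by rewrite ?expf_neq0// gt_eqF.
clearbody T; apply: ler_wpM2r; first exact: prod_norm_ge0.
rewrite -!mulrA; apply: ler_wpM2r.
  by rewrite divr_ge0// exprn_ge0// ltW.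
have sN' : (size s < N.+1)%N by [].
by rewrite (bigD1 (Ordinal sN'))//= lerDl sumr_ge0.
Qed.

End Markov.

(** * Mean value inequalities *)

Section MeanValue.
Context {R : realType}.

(** Subdividing [[0,1]] into [m] pieces leaves an error [K m^(-a)]. *)
Lemma norm_diff_le_of_local {F : normedModType R} (g : R -> F) L K a delta :
  0 < a -> 0 <= K -> 0 < delta ->
  (forall s t, 0 <= s -> s <= t -> t <= 1 -> t - s < delta ->
     `|g t - g s| <= L * (t - s) + K * (t - s) `^ (1 + a)) ->
  `|g 1 - g 0| <= L.
Proof.
move=> a0 K0 d0 H; apply/ler_addgt0Pr => e e0.
have K1 : 0 < K + 1 by lra.
(* A mesh below [eta] is below [delta], and its power [a] is at most [e / (K + 1)], so the errors
   sum to at most [e]. *)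
pose eta := Num.min delta ((e / (K + 1)) `^ a^-1).
have eta0 : 0 < eta by rewrite lt_min d0 powR_gt0// divr_gt0.
have [m etam] : exists m : nat, eta^-1 < m.+1%:R.
  exists (Num.bound eta^-1); apply: lt_trans (archi_boundP _) _.
    by rewrite invr_ge0 ltW.
  by rewrite ltr_nat.
pose x (i : nat) : R := i%:R / m.+1%:R.
have m0 : (m.+1%:R : R) != 0 by [].
have xS i : x i.+1 - x i = m.+1%:R^-1 by rewrite /x -mulrBl -natr1 addrAC subrr add0r mul1r.
have xm : x m.+1 = 1 by rewrite /x mulfV.
have x0 : x 0%N = 0 by rewrite /x mul0r.
have meta : m.+1%:R^-1 < eta by rewrite invf_plt ?posrE.
have B i : (i <= m)%N ->
    `|g (x i.+1) - g (x i)| <= L * m.+1%:R^-1 + K * m.+1%:R^-1 `^ (1 + a).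
  move=> im; rewrite -(xS i); apply: H.
  - by rewrite /x divr_ge0.
  - by rewrite -subr_ge0 xS invr_ge0.
  - by rewrite /x ler_pdivrMr ?mul1r ?ler_nat.
  - by rewrite xS (lt_le_trans meta)// ge_min lexx.
rewrite -xm -x0 -(telescope_sumr (fun i => g (x i)))//.
apply: le_trans (ler_norm_sum _ _ _) _.
rewrite big_mkord; apply: le_trans (_ : _ <= \sum_(i < m.+1)
  (L * m.+1%:R^-1 + K * m.+1%:R^-1 `^ (1 + a))) _.
  by apply: ler_sum => i _; apply: B; rewrite -ltnS.
rewrite sumr_const card_ord -[leLHS]mulr_natr mulrDl divfK// lerD2l.
rewrite powRD ?invr_eq0 ?m0 ?implybT// powRr1 ?invr_ge0//.
rewrite -mulrA (mulrC _^-1) divfK//.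
have : m.+1%:R^-1 `^ a <= e / (K + 1).
  rewrite -[leRHS](_ : (e / (K + 1)) `^ a^-1 `^ a = _); last first.
    by rewrite -powRrM mulVf ?gt_eqF// powRr1// divr_ge0// ltW.
  apply: ge0_ler_powR; rewrite ?nnegrE ?powR_ge0 ?invr_ge0 ?(ltW a0)//.
  by apply: le_trans (ltW meta) _; rewrite ge_min lexx orbT.
move=> /(ler_wpM2l K0)/le_trans; apply.
by rewrite mulrCA ler_piMr ?ltW// ltr_pdivrMr ?mul1r; lra.
Qed.

Lemma exprn_diff_le (s t : R) i : 0 <= s -> s <= t -> t <= 1 ->
  `|t ^+ i - s ^+ i| <= i%:R * (t - s).
Proof.
move=> s0 st t1; have t0 : 0 <= t by lra.
elim: i => [|i IH]; first by rewrite subrr normr0 mul0r.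
have -> : t ^+ i.+1 - s ^+ i.+1 = t * (t ^+ i - s ^+ i) + (t - s) * s ^+ i.
  by rewrite !exprS; ring.
apply: le_trans (ler_normD _ _) _.
rewrite -natr1 [leRHS]mulrDl mul1r; apply: lerD; rewrite normrM ger0_norm//; last 2 first.
- rewrite ler_piMr ?subr_ge0// ger0_norm ?exprn_ge0// exprn_ile1//.
  exact: le_trans t1.
- by rewrite subr_ge0.
by apply: le_trans IH; rewrite ler_piMl.
Qed.

(** The quadratic order makes this error vanish under subdivision, hence the crude constant. *)
Lemma exprn_taylor1_le (s t : R) i : 0 <= s -> s <= t -> t <= 1 ->
  `|t ^+ i.+1 - s ^+ i.+1 - (t - s) * (i.+1%:R * s ^+ i)|
    <= i.+1%:R ^+ 2 * (t - s) ^+ 2.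
Proof.
move=> s0 st t1; elim: i => [|i IH].
  rewrite !expr1 expr0 !mulr1 subrr normr0.
  by rewrite mulr_ge0// exprn_ge0// subr_ge0.
have -> : t ^+ i.+2 - s ^+ i.+2 - (t - s) * (i.+2%:R * s ^+ i.+1) =
  s * (t ^+ i.+1 - s ^+ i.+1 - (t - s) * (i.+1%:R * s ^+ i)) +
  (t - s) * (t ^+ i.+1 - s ^+ i.+1).
  by rewrite -(natr1 i.+1) !exprS; ring.
apply: le_trans (ler_normD _ _) _; rewrite !normrM ger0_norm//.
rewrite (ger0_norm (_ : 0 <= t - s)) ?subr_ge0//.
apply: le_trans (_ : _ <= i.+1%:R ^+ 2 * (t - s) ^+ 2 +
  (t - s) * (i.+1%:R * (t - s))) _.
  apply: lerD; first by apply: le_trans IH; rewrite ler_piMl// (le_trans st).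
  by rewrite ler_wpM2l ?subr_ge0// exprn_diff_le.
rewrite -(natr1 i.+1).
have : 0 <= (t - s) ^+ 2 by rewrite sqr_ge0.
have : 0 <= (i.+1%:R : R) by [].
by set u := t - s; set k := i.+1%:R; nra.
Qed.

End MeanValue.

(** * Taylor estimates on a convex set *)

Section TaylorEstimates.
Context {R : realType} {E F : normedModType R}.
Variables (n : nat) (eps M : R) (D : set E) (f : E -> F) (J : E -> seq E -> F).
Hypotheses (eps0 : 0 < eps) (eps1 : eps <= 1) (M0 : 0 <= M).
Hypothesis convD : forall x y t, D x -> D y -> 0 <= t -> t <= 1 ->
  D (y + t *: (x - y)).
Hypothesis Jl : forall x, D x -> mlin (J x).
Hypothesis Jb : forall x, D x -> mbnd M (J x).
Hypothesis J1 : forall x y u, D x -> D y ->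
  `|J x [:: u] - \sum_(i < n.+1) (i`!%:R)^-1 *: J y (u :: nseq i (x - y))|
    <= M * `|x - y| `^ (n%:R + eps) * `|u|.
Hypothesis f0 : exists2 Mt : R, 0 <= Mt & exists2 d : R, 0 < d &
  forall x y, D x -> D y -> `|x - y| < d ->
  `|f x - f y - \sum_(i < n.+1) (i.+1`!%:R)^-1 *: J y (nseq i.+1 (x - y))|
    <= Mt * `|x - y| `^ (n.+1%:R + eps).

Let invfact_le1 k : (k`!%:R : R)^-1 <= 1.
Proof. by rewrite invf_le1 ?ltr0n ?fact_gt0// ler1n fact_gt0. Qed.

(** [K] and [d] are not controlled by [M]: they only enter errors that vanish under subdivision in
    [norm_diff_le_of_local]. Terms of degree at least 2 are absorbed because [1 + eps <= 2]. *)
Lemma local_linearization : exists2 K : R, 0 <= K & exists2 d : R, 0 < d &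
  forall x y, D x -> D y -> `|x - y| < d ->
  `|f x - f y - J y [:: x - y]| <= K * `|x - y| `^ (1 + eps).
Proof.
have [Mt Mt0 [d d0 H]] := f0.
exists (Mt + n%:R * M); first by rewrite addr_ge0// mulr_ge0.
exists (Num.min d 1); first by rewrite lt_min d0 ltr01.
move=> x y Dx Dy; rewrite lt_min => /andP[xd x1].
have := H x y Dx Dy xd; rewrite big_ord_recl/= factS fact0 muln1 invr1 scale1r.
set h := x - y in xd x1 *; set S := \sum_(i < n) _ => HS.
have h0 : 0 <= `|h| by [].
have hp (t : R) : 1 + eps <= t -> `|h| `^ t <= `|h| `^ (1 + eps).
  move=> tt; have e0 : 0 < 1 + eps by rewrite ltr_wpDl.
  by have := powR_le_powR h0 (ltW x1) e0 tt; rewrite powR1 mul1r.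
have -> : f x - f y - J y [:: h] = (f x - f y - (J y [:: h] + S)) + S.
  by rewrite opprD addrA subrK.
apply: le_trans (ler_normD _ _) _; rewrite mulrDl; apply: lerD.
  apply: le_trans HS _; rewrite ler_wpM2l// hp// lerD2r ler1n.
  by [].
apply: le_trans (ler_norm_sum _ _ _) _.
apply: le_trans (_ : _ <= \sum_(i < n) M * `|h| `^ (1 + eps)) _; last first.
  by rewrite sumr_const card_ord -[leLHS]mulr_natl mulrA.
apply: ler_sum => i _; rewrite normrZ normfV normr_nat.
apply: le_trans (_ : _ <= 1 * (M * `|h| ^+ i.+2)) _.
  apply: ler_pM => //; rewrite ?invr_ge0//.
  exact: (mbnd_nseq i.+2 h (Jb Dy)).
rewrite mul1r ler_wpM2l// -powR_mulrn// hp//.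
apply: le_trans (_ : 1 + 1 <= _); first by rewrite lerD2l.
by rewrite -(natrD _ 1 1) ler_nat.
Qed.

(** Along a segment the derivative of [f - A] has norm at most [q], and the linearization error
    vanishes under subdivision. *)
Lemma norm_diff_linear_le (A : E -> F) q (D' : set E) :
  D' `<=` D -> linear A ->
  (forall x y t, D' x -> D' y -> 0 <= t -> t <= 1 -> D' (y + t *: (x - y))) ->
  (forall x u, D' x -> `|J x [:: u] - A u| <= q * `|u|) ->
  forall x y, D' x -> D' y -> `|f x - f y - A (x - y)| <= q * `|x - y|.
Proof.
move=> D'D Al convD' HA x y D'x D'y.
have [K K0 [d d0 H]] := local_linearization.
set z := x - y.
pose g t := f (y + t *: z) - t *: A z.
have -> : f x - f y - A z = g 1 - g 0.
  by rewrite /g scale1r !scale0r addr0 subr0 scale1r /z (addrC y) subrK addrAC.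
apply: (@norm_diff_le_of_local _ _ g _ (K * `|z| `^ (1 + eps)) eps (d / (`|z| + 1))).
- by [].
- by rewrite mulr_ge0// powR_ge0.
- by rewrite divr_gt0// ltr_wpDl.
move=> s t s0 st t1 tsd.
have t0 : 0 <= t by exact: le_trans st.
have s1 : s <= 1 by exact: le_trans t1.
have ts0 : 0 <= t - s by rewrite subr_ge0.
have Ds : D' (y + s *: z) by exact: convD'.
have Dt : D' (y + t *: z) by exact: convD'.
have zts : (y + t *: z) - (y + s *: z) = (t - s) *: z.
  by rewrite opprD addrACA subrr add0r scalerBl.
clearbody z.
have -> : g t - g s =
  (f (y + t *: z) - f (y + s *: z) - J (y + s *: z) [:: (t - s) *: z]) +
  (t - s) *: (J (y + s *: z) [:: z] - A z).
  rewrite (mlinZ [::])//=; last by apply: Jl; exact: D'D.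
  rewrite scalerBr addrA subrK /g scalerBl.
  by rewrite !opprD !opprK !addrA [LHS](ACl (1 * 3 * 2 * 4)).
apply: le_trans (ler_normD _ _) _; rewrite addrC; apply: lerD.
  rewrite normrZ ger0_norm// mulrC ler_wpM2r//; exact: HA.
rewrite -zts; apply: le_trans (H _ _ (D'D _ Dt) (D'D _ Ds) _) _; rewrite zts.
  rewrite normrZ ger0_norm//.
  apply: le_lt_trans (_ : (t - s) * (`|z| + 1) < d).
    by rewrite ler_wpM2l// lerDl.
  by rewrite -ltr_pdivlMr// ltr_wpDl.
by rewrite normrZ ger0_norm// powRM// mulrA mulrAC.
Qed.

(** The derivative in [t] of [f(y + t z)] minus its Taylor polynomial is the order 1 remainder
    between [y + t z] and [y], at most [M |z|^(n + 1 + eps)]. The constant and the scale given by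
    [f0] thus disappear. *)
Lemma taylor_remainder_le x y : D x -> D y ->
  `|f x - f y - \sum_(i < n.+1) (i.+1`!%:R)^-1 *: J y (nseq i.+1 (x - y))|
    <= M * `|x - y| `^ (n.+1%:R + eps).
Proof.
move=> Dx Dy.
have [K K0 [d d0 H]] := local_linearization.
set z := x - y.
pose c i := (i.+1`!%:R)^-1 *: J y (nseq i.+1 z).
pose g t := f (y + t *: z) - \sum_(i < n.+1) t ^+ i.+1 *: c i.
have -> : f x - f y - \sum_(i < n.+1) (i.+1`!%:R)^-1 *: J y (nseq i.+1 z) = g 1 - g 0.
  rewrite /g scale1r !scale0r addr0 /z addrC [X in _ = _ - (_ - X)]big1; last first.
    by move=> i _; rewrite expr0n scale0r.
  rewrite subr0 (addrC y) subrK addrC addrAC; congr (_ - _ - _).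
  by apply: eq_bigr => i _; rewrite expr1n scale1r.
pose K' := K * `|z| `^ (1 + eps) + \sum_(i < n.+1) i.+1%:R ^+ 2 * `|c i|.
apply: (@norm_diff_le_of_local _ _ g _ K' eps (d / (`|z| + 1))).
- by [].
- apply: addr_ge0; first by rewrite mulr_ge0// powR_ge0.
  by apply: sumr_ge0 => i _; apply: mulr_ge0.
- by rewrite divr_gt0// ltr_wpDl.
move=> s t s0 st t1 tsd.
have t0 : 0 <= t by exact: le_trans st.
have s1 : s <= 1 by exact: le_trans t1.
have ts0 : 0 <= t - s by rewrite subr_ge0.
have Ds : D (y + s *: z) by exact: convD.
have Dt : D (y + t *: z) by exact: convD.
have zts : (y + t *: z) - (y + s *: z) = (t - s) *: z.
  by rewrite opprD addrACA subrr add0r scalerBl.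
clearbody z.
(* The linearization error of [f], the Taylor errors of the monomials, and [t - s] times the
   derivative of [g] at [s]. *)
have -> : g t - g s =
  ((f (y + t *: z) - f (y + s *: z) - J (y + s *: z) [:: (t - s) *: z]) -
  \sum_(i < n.+1)
     (t ^+ i.+1 - s ^+ i.+1 - (t - s) * (i.+1%:R * s ^+ i)) *: c i) +
  (t - s) *: (J (y + s *: z) [:: z] - \sum_(i < n.+1) (i.+1%:R * s ^+ i) *: c i).
  rewrite (mlinZ [::])//=; last exact: Jl.
  rewrite (eq_bigr (fun i : 'I_n.+1 => t ^+ i.+1 *: c i - s ^+ i.+1 *: c i -
    (t - s) *: ((i.+1%:R * s ^+ i) *: c i))); last first.
    by move=> i _; rewrite (scalerA (t - s)) -!scalerBl.
  rewrite !sumrB -scaler_sumr scalerBr /g.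
  set A := f _; set B := f _; set C := _ *: J _ _; set X := \sum_(_ < _) _.
  set Y := \sum_(_ < _) _; set Z := _ *: \sum_(_ < _) _.
  rewrite !opprD !opprK !addrA.
  rewrite [RHS](ACl (1 * 4 * 2 * 5 * (3 * 7) * (6 * 8)))/=.
  by rewrite addNr subrr !addr0.
apply: le_trans (ler_normD _ _) _; rewrite addrC; apply: lerD.
  rewrite normrZ ger0_norm// mulrC ler_wpM2r//.
  rewrite (eq_bigr (fun i : 'I_n.+1 => (i`!%:R)^-1 *:
     J y (z :: nseq i ((y + s *: z) - y)))); last first.
    move=> i _; rewrite addrC addKr /c scalerA.
    have := mlin_scale_nseq [:: z] [::] i s z (Jl Dy); rewrite !cats0/= => ->.
    rewrite scalerA; congr (_ *: _); rewrite factS natrM invfM mulrACA mulfV//.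
    by rewrite mul1r mulrC.
  apply: le_trans (J1 z Ds Dy) _; rewrite -mulrA ler_wpM2l//.
  rewrite addrC addKr normrZ ger0_norm// powRM// -natr1 -addrA (addrC 1) addrA.
  rewrite (@powRD _ `|z| (n%:R + eps) 1); last by rewrite gt_eqF// addr_gt0// ltr_wpDl.
  rewrite powRr1// ler_wpM2r// ler_piMl ?powR_ge0//.
  apply: le_trans (_ : _ <= 1 `^ (n%:R + eps)) _; last by rewrite powR1.
  by apply: ge0_ler_powR; rewrite ?nnegrE// addr_ge0// ltW.
apply: le_trans (ler_normB _ _) _; rewrite mulrDl; apply: lerD.
  rewrite -zts; apply: le_trans (H _ _ Dt Ds _) _; rewrite zts.
    rewrite normrZ ger0_norm//.
    apply: le_lt_trans (_ : (t - s) * (`|z| + 1) < d).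
      by rewrite ler_wpM2l// lerDl.
    by rewrite -ltr_pdivlMr// ltr_wpDl.
  by rewrite normrZ ger0_norm// powRM// mulrA mulrAC.
apply: le_trans (ler_norm_sum _ _ _) _; rewrite mulr_suml; apply: ler_sum => i _.
rewrite normrZ mulrAC ler_wpM2r//.
apply: le_trans (exprn_taylor1_le _ s0 st t1) _; rewrite ler_wpM2l ?exprn_ge0//.
have ts1 : t - s <= 1 by lra.
rewrite -powR_mulrn//; have := @powR_le_powR _ (t - s) 1 2 (1 + eps) ts0 ts1.
by rewrite powR1 mul1r; apply; move: eps0 eps1; lra.
Qed.

End TaylorEstimates.

(** * Perturbations of the identity *)

Section Perturbation.
Context {R : realType} {E : completeNormedModType R}.

(** A solution of [G v = u] is a fixed point of the contraction [v - G v + u]. *)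
Lemma perturbed_id_surj (G : E -> E) (a q : R) u : 0 <= q -> q < 1 ->
  G 0 = 0 ->
  (forall v w, `|v| < a -> `|w| < a -> `|G v - G w - (v - w)| <= q * `|v - w|) ->
  `|u| < (1 - q) * a -> exists2 v, `|v| < a & G v = u.
Proof.
move=> q0 q1 G0 H ua.
have q1' : 0 < 1 - q by rewrite subr_gt0.
(* Solves [q * rho + |u| = rho], so the closed ball of radius [rho] is stable; the bound on [u]
   makes it smaller than [a]. *)
pose rho := `|u| / (1 - q).
have rho0 : 0 <= rho by rewrite divr_ge0// ltW.
have rhoa : rho < a by rewrite ltr_pdivrMr// mulrC.
have a0 : 0 < a by exact: le_lt_trans rhoa.
pose U := closed_ball_ (fun x : E => `|x|) (0 : E) rho.
have UE v : U v <-> `|v| <= rho by rewrite /U /closed_ball_/= sub0r normrN.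
pose T v := v - G v + u.
have TE v w : T v - T w = - (G v - G w - (v - w)).
  rewrite /T opprD addrACA subrr addr0 !opprB addrACA [RHS]addrACA.
  by rewrite (addrC (- G v)).
have TU : {homo T : v / U v >-> U v}.
  move=> v /UE vrho; apply/UE.
  have := H v 0; rewrite G0 !subr0 normr0 => /(_ (le_lt_trans vrho rhoa) a0) Gv.
  apply: le_trans (ler_normD _ _) _.
  have -> : rho = q * rho + `|u| by rewrite /rho; field; rewrite gt_eqF.
  by rewrite lerD2r distrC (le_trans Gv)// ler_wpM2l.
have [|||v /UE vrho vE] := @banach_fixed_point R E U (mkfun_fun TU).
- exists (NngNum q0); split => //= -[v w] [/= /UE vr /UE wr].
  have := H v w (le_lt_trans vr rhoa) (le_lt_trans wr rhoa).
  by rewrite -normrN -TE.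
- exact: closed_closed_ball_.
- by exists 0; apply/UE; rewrite normr0.
exists v; first exact: le_lt_trans rhoa.
have {}vE : v = v - G v + u by [].
have : v + G v = v + u.
  by rewrite {1}vE addrAC subrK.
by move/addrI.
Qed.

Lemma perturbed_id_lower (x y : E) q :
  `|x - y| <= q * `|y| -> (1 - q) * `|y| <= `|x|.
Proof.
move=> H; have := ler_normD (y - x) x; rewrite subrK distrC; move: H.
set a := `|_ - _|; set b := `|y|; set c := `|x|; lra.
Qed.

(** [B \o T] is a linear perturbation of the identity, hence bijective; injectivity of [B] then
    turns [T] itself into a bijection. *)
Lemma perturbed_left_inverse (A B T : E -> E) (q M2 : R) :
  0 <= q -> q < 1 -> linear B -> linear T -> cancel B A -> 
  (forall v, `|B v| <= M2 * `|v|) ->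
  (forall u, `|B (T u) - u| <= q * `|u|) ->
  exists S, [/\ linear S, cancel T S &
    forall w, (1 - q) * `|S w| <= M2 * `|w|].
Proof.
move=> q0 q1 Bl Tl BK Bb BT.
have q1' : 0 < 1 - q by rewrite subr_gt0.
have BTD u v : B (T u) - B (T v) = B (T (u - v)).
  by rewrite (linear_subE _ _ Tl) (linear_subE _ _ Bl).
have BT0 : B (T 0) = 0 by have := BTD 0 0; rewrite !subrr => <-.
have /choice[S TS] : forall w, exists h, T h = w.
  (* The perturbation bound holds on the whole space, so the radius can be adapted to [w]. *)
  move=> w; have [|||h _ hE] := @perturbed_id_surj (B \o T)
    ((`|B w| + 1) / (1 - q)) q (B w) q0 q1.
  - exact: BT0.
  - by move=> v v' _ _ /=; rewrite BTD.
  - by rewrite mulrC divfK ?gt_eqF// ltrDl.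
  by exists h; apply: (can_inj BK).
have Tinj : injective T.
  move=> u v uv; apply/eqP; rewrite -subr_eq0 -normr_le0.
  have := perturbed_id_lower (BT (u - v)); rewrite -BTD uv subrr normr0.
  by rewrite pmulr_rle0.
exists S; split.
- by move=> c u v; apply: Tinj; rewrite Tl !TS.
- by move=> u; apply: Tinj; rewrite TS.
- move=> w; apply: le_trans (Bb w); rewrite -{2}(TS w).
  exact: perturbed_id_lower.
Qed.

End Perturbation.

(** * Jets and symmetrization *)

Section Symmetrization.
Context {R : realType} {E F : lmodType R}.

Lemma tset_cat k (v : k.-tuple E) (i : 'I_k) u :
  tval (tset v i u) = take i v ++ u :: drop i.+1 v.
Proof.
apply: (@eq_from_nth _ 0).
  rewrite size_tuple size_cat/= size_take size_drop size_tuple ltn_ord.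
  by have := ltn_ord i; lia.
move=> j; rewrite size_tuple => jk.
rewrite -(tnth_nth 0 _ (Ordinal jk)) tnth_mktuple nth_cat size_take size_tuple.
rewrite ltn_ord -val_eqE/=.
have [ji|ji|->] := ltngtP j i.
- by rewrite nth_take// (tnth_nth 0).
- have -> : (j - i = (j - i.+1).+1)%N by lia.
  by rewrite /= nth_drop (tnth_nth 0)/=; congr nth; lia.
- by rewrite subnn.
Qed.

Lemma mlin_multilinear k (q : seq E -> F) :
  mlin q -> multilinear (fun v : k.-tuple E => q v).
Proof. by move=> ql v i c u w; rewrite !tset_cat ql. Qed.

(** Lists instead of sized tuples avoid transports between equal sizes when arguments are
    concatenated. *)
Definition jet_seq (f : forall k, k.-tuple E -> F) (s : seq E) : F :=
  f (size s) (in_tuple s).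

Lemma jet_seqE (f : forall k, k.-tuple E -> F) k (v : k.-tuple E) :
  jet_seq f v = f k v.
Proof.
case: v => s sk; rewrite /jet_seq/=; move: (sk); rewrite -(eqP sk) => sk'.
by congr (f _ _); apply: val_inj.
Qed.

Lemma jet_seq_mlin (f : forall k, k.-tuple E -> F) :
  (forall k, multilinear (f k)) -> mlin (jet_seq f).
Proof.
move=> fl s1 s2 c u v /=.
pose k := size (s1 ++ 0 :: s2).
have ik : (size s1 < k)%N by rewrite /k size_cat/=; lia.
have sE w : s1 ++ w :: s2 = tset (in_tuple (s1 ++ 0 :: s2)) (Ordinal ik) w.
  rewrite tset_cat/= take_size_cat// drop_cat ltnNge leqnSn/=.
  by rewrite subSnn/= drop0.
by rewrite (sE u) (sE v) (sE (c *: u + v)) !jet_seqE fl.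
Qed.

Lemma jet_seq_perm_invariant (f : forall k, k.-tuple E -> F) :
  (forall k s v, f k (tperm_act s v) = f k v) -> perm_invariant (jet_seq f).
Proof.
move=> fs s t st; rewrite perm_sym in st.
have /eqP sz := perm_size st.
have /tuple_permP[p pE] : perm_eq (Tuple sz) (in_tuple s) by [].
have -> : t = tperm_act p (in_tuple s) by rewrite -[LHS]/(tval (Tuple sz)) pE.
by rewrite jet_seqE fs.
Qed.

Lemma tperm_act_comp k (s t : 'S_k) (v : k.-tuple E) :
  tperm_act s (tperm_act t v) = tperm_act (s * t)%g v.
Proof. by apply: eq_from_tnth => i; rewrite !tnth_mktuple permM. Qed.

Lemma tperm_act_tset k (s : 'S_k) (v : k.-tuple E) i u :
  tperm_act s (tset v i u) = tset (tperm_act s v) (s^-1 i)%g u.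
Proof.
apply: eq_from_tnth => j; rewrite !tnth_mktuple.
by rewrite (can2_eq (permK s) (permKV s)).
Qed.

End Symmetrization.

Section Symmetrize.
Context {R : realType} {E F : normedModType R}.

(** The sum over permutations is not divided by [k!]: its factor on the diagonal cancels the [1/k!]
    of Taylor polynomials, so homogeneous parts become derivatives. *)
Lemma symmetrize (q : seq E -> F) C : mlin q -> mbnd C q ->
  exists p, [/\ mlin p, perm_invariant p,
    forall k w, p (nseq k w) = k`!%:R *: q (nseq k w) &
    forall s, `|p s| <= (size s)`!%:R * (C * \prod_(u <- s) `|u|)].
Proof.
move=> ql qb.
pose f k (v : k.-tuple E) := \sum_(s : 'S_k) q (tperm_act s v).
exists (jet_seq f); split.
- apply: jet_seq_mlin => k v i c u w; rewrite /f scaler_sumr -big_split.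
  by apply: eq_bigr => s _; rewrite !tperm_act_tset; exact: mlin_multilinear.
- apply: jet_seq_perm_invariant => k s v; rewrite /f.
  rewrite [RHS](reindex_inj (mulIg s)); apply: eq_bigr => t _.
  by rewrite tperm_act_comp.
- move=> k w; rewrite -[nseq k w]/(tval (nseq_tuple k w)) jet_seqE /f.
  rewrite (eq_bigr (fun=> q (nseq k w))); last first.
    move=> s _; congr q; rewrite -[RHS]/(tval (nseq_tuple k w)); congr tval.
    by apply: eq_from_tnth => i; rewrite tnth_mktuple !tnth_nseq.
  by rewrite sumr_const card_Sn scaler_nat.
- move=> s; apply: le_trans (ler_norm_sum _ _ _) _.
  rewrite mulr_natl -card_Sn -sumr_const; apply: ler_sum => t _.
  apply: le_trans (qb _) _; rewrite le_eqVlt; apply/orP; left; apply/eqP.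
  congr (_ * _); apply: perm_big.
  have : perm_eq (tperm_act t (in_tuple s)) (in_tuple s).
    by apply/tuple_permP; exists t.
  by [].
Qed.

End Symmetrize.

(** * The jet of the inverse map *)

Section InverseExpansion.
Context {R : realType}.

(** By [taylor_shift] the remainders are the coefficients of a difference of two approximations of
    [g], to which [jet_coef_bound] applies with radius [c |x - y|]. *)
Lemma jet_remainder_bound N (c theta : R) : 0 < c -> 0 < theta ->
  exists2 K : R, 0 <= K & forall (E F : normedModType R) (g : E -> F)
    (p : E -> seq E -> F) x y C,
  let px := p x in let py := p y in 0 <= C ->
  mlin px -> perm_invariant px -> mlin py -> perm_invariant py ->
  (forall w, `|w| <= c * `|x - y| ->
    `|g (x + w) - \sum_(k < N.+1) (k`!%:R)^-1 *: px (nseq k w)|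
      <= C * `|w| `^ theta /\
    `|g (x + w) - \sum_(k < N.+1) (k`!%:R)^-1 *: py (nseq k (w + (x - y)))|
      <= C * `|w + (x - y)| `^ theta) ->
  forall s, (size s <= N)%N ->
  `|px s - \sum_(i < (N - size s).+1) (i`!%:R)^-1 *: py (s ++ nseq i (x - y))|
    <= K * C * `|x - y| `^ (theta - (size s)%:R) * \prod_(u <- s) `|u|.
Proof.
move=> c0 t0; have [K K0 HK] := @jet_coef_bound R N.
(* [c1 ^ N] dominates the factors [c^(-k)], [k <= N], due to the radius; [L] collects the bounds
   [|w| <= c |z|] and [|w + z| <= (c + 1) |z|]. *)
pose c1 := 1 + c^-1.
have c11 : 1 <= c1 by rewrite lerDl invr_ge0 ltW.
pose L := c `^ theta + (c + 1) `^ theta.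
have L0 : 0 <= L by rewrite addr_ge0// powR_ge0.
have c1N : 0 <= c1 ^+ N by rewrite exprn_ge0// (le_trans ler01).
exists (K * L * c1 ^+ N); first by rewrite mulr_ge0// mulr_ge0.
move=> E F g p x y C px py C0 pxl pxp pyl pyp H s sN.
set z := x - y in H *.
have [z0|z0] := eqVneq z 0.
  rewrite z0 big_ord_recl/= fact0 invr1 scale1r cats0 big1 ?addr0 ?subrr.
    rewrite /px /py (subr0_eq z0) subrr normr0 mulr_ge0 ?prod_norm_ge0//.
    by rewrite mulr_ge0 ?powR_ge0// !mulr_ge0.
  by move=> i _; rewrite (mlin0 s _ pyl) scaler0.
have nz0 : 0 < `|z| by rewrite normr_gt0.
pose r s := px s - \sum_(i < (N - size s).+1) (i`!%:R)^-1 *: py (s ++ nseq i z).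
have rl : mlin r.
  move=> s1 s2 a u v; rewrite /r !size_cat/= pxl.
  rewrite (eq_bigr (fun i : 'I_(N - (size s1 + (size s2).+1)).+1 =>
     a *: ((i`!%:R)^-1 *: py ((s1 ++ u :: s2) ++ nseq i z)) +
     (i`!%:R)^-1 *: py ((s1 ++ v :: s2) ++ nseq i z))); last first.
    by move=> i _; rewrite -!catA pyl scalerDr !scalerA mulrC.
  by rewrite big_split/= -scaler_sumr scalerBr opprD addrACA.
have rp : perm_invariant r.
  move=> s1 s2 s12; rewrite /r (perm_size s12) (pxp _ _ s12); congr (_ - _).
  by apply: eq_bigr => i _; congr (_ *: _); apply: pyp; rewrite perm_cat2r.
have rE w : \sum_(k < N.+1) (k`!%:R)^-1 *: r (nseq k w) =
    \sum_(k < N.+1) (k`!%:R)^-1 *: px (nseq k w) -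
    \sum_(k < N.+1) (k`!%:R)^-1 *: py (nseq k (w + z)).
  rewrite taylor_shift// -sumrB; apply: eq_bigr => k _.
  by rewrite /r size_nseq scalerBr.
have rb w : `|w| <= c * `|z| ->
    `|\sum_(k < N.+1) (k`!%:R)^-1 *: r (nseq k w)| <= C * L * `|z| `^ theta.
  move=> wz; have [Hx Hy] := H w wz; rewrite rE.
  set X := \sum_(_ < _) _ in Hx *; set Y := \sum_(_ < _) _ in Hy *.
  have -> : X - Y = (g (x + w) - Y) - (g (x + w) - X).
    by rewrite opprB [RHS]addrC addrA subrK.
  apply: le_trans (ler_normB _ _) _.
  have -> : C * L * `|z| `^ theta =
      C * ((c + 1) * `|z|) `^ theta + C * (c * `|z|) `^ theta.
    by rewrite !powRM ?addr_ge0 ?(ltW c0)// /L; ring.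
  apply: lerD.
    apply: le_trans Hy _; rewrite ler_wpM2l//; apply: ge0_ler_powR.
    - exact: ltW.
    - by rewrite nnegrE.
    - by rewrite nnegrE mulr_ge0// addr_ge0// ltW.
    - by rewrite mulrDl mul1r; apply: le_trans (ler_normD _ _) _; rewrite lerD2r.
  apply: le_trans Hx _; rewrite ler_wpM2l//.
  by apply: ge0_ler_powR; rewrite ?nnegrE ?mulr_ge0 ?(ltW c0) ?(ltW t0).
have cz0 : 0 < c * `|z| by rewrite mulr_gt0.
apply: le_trans (HK E F r _ _ rl rp cz0 rb s sN) _.
apply: ler_wpM2r; first exact: prod_norm_ge0.
rewrite powRB ?normr_eq0 ?z0 ?implybT// powR_mulrn// exprMn invfM.
have -> : K * (C * L * `|z| `^ theta) * (c ^- size s * `|z| ^- size s) =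
  K * L * C * (`|z| `^ theta / `|z| ^+ size s) * c ^- size s by ring.
have -> : K * L * c1 ^+ N * C * (`|z| `^ theta / `|z| ^+ size s) =
  K * L * C * (`|z| `^ theta / `|z| ^+ size s) * c1 ^+ N by ring.
apply: ler_wpM2l.
  by rewrite mulr_ge0 ?divr_ge0 ?powR_ge0 ?exprn_ge0// mulr_ge0// mulr_ge0.
apply: le_trans (_ : _ <= c1 ^+ size s) _; last exact: ler_weXn2l.
rewrite -exprVn; apply: lerXn2r; rewrite ?nnegrE ?invr_ge0 ?(ltW c0)//.
  exact: le_trans c11.
by rewrite lerDr.
Qed.

(** Dividing [a] by factorials makes its Taylor polynomial a plain sum, ready for
    [expansion_exists]; [symmetrize] then restores symmetry and the factorials. *)
Lemma inverse_expansion n (eps M1 M2 : R) :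
  0 < eps -> eps <= 1 -> 0 <= M1 -> 0 <= M2 ->
  exists2 C : R, 0 <= C & forall (E : normedModType R) (a : seq E -> E)
    (S : E -> E),
  mlin a -> mbnd M1 a -> linear S -> (forall w, `|S w| <= 2 * M2 * `|w|) ->
  cancel (fun u => a [:: u]) S ->
  exists p, [/\ mlin p, perm_invariant p,
    forall s, (size s <= n.+1)%N -> `|p s| <= C * \prod_(u <- s) `|u| &
    forall w h, `|w| <= 2 * M1 -> `|h| <= 2 * M2 * `|w| ->
      `|w - \sum_(i < n.+1) (i.+1`!%:R)^-1 *: a (nseq i.+1 h)|
        <= M1 * `|h| `^ (n.+1%:R + eps) ->
      `|h - \sum_(k < n.+1) (k.+1`!%:R)^-1 *: p (nseq k.+1 w)|
        <= C * `|w| `^ (n.+1%:R + eps)].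
Proof.
move=> eps0 eps1 M10 M20.
set theta := n.+1%:R + eps.
have theta0 : 0 < theta by rewrite ltr_wpDl.
(* The first term bounds [h] by [w], the second the image under [S] of the Taylor error. *)
pose C0 := 2 * M2 + 2 * M2 * (M1 * (2 * M2) `^ theta).
have M220 : 0 <= 2 * M2 by rewrite mulr_ge0.
have C00 : 0 <= C0 by rewrite addr_ge0// !mulr_ge0// powR_ge0.
have W0 : 0 <= 2 * M1 by rewrite mulr_ge0.
have [||C C_ge0 HC] := @expansion_exists R n theta M1 (2 * M2) C0 (2 * M1) M10 M220 C00 W0.
- by rewrite ltrDl.
- by rewrite /theta -(natr1 n.+1) lerD2l.
exists (n.+1`!%:R * C); first by rewrite mulr_ge0.
move=> E a S al ab Sl Sb SK.
pose b s := ((size s)`!%:R)^-1 *: a s.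
have bl : mlin b.
  move=> s1 s2 c u v; rewrite /b !size_cat/= al scalerDr !scalerA.
  by rewrite (mulrC c).
have bb : mbnd M1 b.
  move=> s; rewrite /b normrZ; apply: le_trans (ab s).
  rewrite ler_piMl// normfV normr_nat invf_le1 ?ltr0n ?fact_gt0//.
  by rewrite ler1n fact_gt0.
have [q [ql qb qE]] := HC E b S bl bb Sl Sb.
have [p [pl pp pE pb]] := symmetrize ql qb.
exists p; split => //.
  move=> s sn; apply: le_trans (pb _) _; rewrite -mulrA ler_wpM2r//.
    by rewrite mulr_ge0// prod_norm_ge0.
  by rewrite ler_nat leq_fact.
move=> w h wW hw Hr.
rewrite (eq_bigr (fun k : 'I_n.+1 => q (nseq k.+1 w))); last first.
  by move=> k _; rewrite pE scalerA mulVf ?scale1r// pnatr_eq0 -lt0n fact_gt0.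
apply: le_trans (qE w h wW _ _) _.
- by apply: le_trans hw _; rewrite ler_wpM2r// lerDl !mulr_ge0// powR_ge0.
(* As [S] inverts the linear part of [a], the defect in the equation for [h] is [- S Y], with [Y]
   the Taylor error. *)
- set Y := w - \sum_(i < n.+1) _ in Hr.
  have -> : h - S (w - \sum_(j < n) b (nseq j.+2 h)) = - S Y.
    have -> : w - \sum_(j < n) b (nseq j.+2 h) = a [:: h] - (0 - Y).
      rewrite sub0r opprK /Y big_ord_recl/= factS fact0 muln1 invr1 scale1r opprD.
      rewrite addrCA addNKr; congr (_ - _); apply: eq_bigr => i _.
      by rewrite /b/= size_nseq.
    rewrite (linear_subE _ _ Sl) SK (linear_subE _ _ Sl).
    have -> : S 0 = 0 by have := linear_subE 0 0 Sl; rewrite !subrr.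
    by rewrite sub0r opprK opprD addNKr.
  rewrite normrN; apply: le_trans (Sb _) _.
  apply: le_trans (_ : _ <= 2 * M2 * (M1 * (2 * M2) `^ theta) * `|w| `^ theta) _.
    apply: le_trans (ler_wpM2l M220 Hr) _.
    rewrite -(mulrA (2 * M2) (M1 * _)) -(mulrA M1); do 2!(apply: ler_wpM2l => //).
    rewrite -powRM//; apply: ge0_ler_powR; rewrite ?nnegrE ?mulr_ge0 ?(ltW theta0)//.
  by rewrite ler_wpM2r ?powR_ge0// lerDr.
rewrite ler_wpM2r ?powR_ge0// ler_peMl// ler1n fact_gt0.
by [].
Qed.

End InverseExpansion.

Section InverseJet.
Context {R : realType}.

(** The expansions have no constant term; this inserts the value of the inverse map as the component
    of order 0. *)
Definition set_nil (E : eqType) (F : Type) (c : F) (p : seq E -> F) s :=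
  if s is [::] then c else p s.

Lemma set_nil_mlin {E F : lmodType R} c (p : seq E -> F) :
  mlin p -> mlin (set_nil c p).
Proof. by move=> pl [|x s1]; [exact: (pl [::])|exact: (pl (x :: s1))]. Qed.

Lemma set_nil_perm_invariant (E : eqType) (F : Type) c (p : seq E -> F) :
  perm_invariant p -> perm_invariant (set_nil c p).
Proof.
by move=> pp [|x s] [|y t] // st; [have := perm_size st|have := perm_size st|exact: pp].
Qed.

(** Naming the property allows [C] to be chosen as a function of [M1] and [M2] before the space and
    the map are given. The value of the inverse at [y] is [p y [::]]. *)
Definition inverse_jet_bound n (eps M1 M2 C : R) : Prop :=
  forall (E : completeNormedModType R)
    (f : E -> E) (J : E -> seq E -> E) (A B : E -> E) x0 alpha,
  let D x := `|x - x0| < alpha in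
  let V y := `|B (y - f x0)| < alpha / 2 in
  0 < alpha -> alpha <= 1 -> linear A -> linear B -> cancel B A ->
  (forall v, `|A v| <= M1 * `|v|) -> (forall v, `|B v| <= M2 * `|v|) ->
  (forall x, D x -> mlin (J x)) -> (forall x, D x -> mbnd M1 (J x)) ->
  (forall x u, D x -> `|B (J x [:: u]) - u| <= 10^-1 * `|u|) ->
  (forall x y, D x -> D y ->
    `|B (f x - f y) - (x - y)| <= 10^-1 * `|x - y|) ->
  (forall x y, D x -> D y ->
    `|f x - f y - \sum_(i < n.+1) (i.+1`!%:R)^-1 *: J y (nseq i.+1 (x - y))|
      <= M1 * `|x - y| `^ (n.+1%:R + eps)) ->
  exists p : E -> seq E -> E, [/\
    forall y, V y -> D (p y [::]) /\ f (p y [::]) = y,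
    forall x y, D x -> D y -> f x = f y -> x = y,
    forall y, mlin (p y) /\ perm_invariant (p y),
    forall y s, V y -> (0 < size s <= n.+1)%N ->
      `|p y s| <= C * \prod_(u <- s) `|u| &
    forall x y s, V x -> V y -> (size s <= n.+1)%N ->
      `|p x s - \sum_(i < (n.+1 - size s).+1)
          (i`!%:R)^-1 *: p y (s ++ nseq i (x - y))|
        <= C * `|x - y| `^ (n.+1%:R + eps - (size s)%:R)
             * \prod_(u <- s) `|u|].
Lemma inverse_jet n (eps M1 M2 : R) :
  0 < eps -> eps <= 1 -> 0 < M1 -> 0 < M2 ->
  exists2 C : R, 0 <= C & inverse_jet_bound n eps M1 M2 C.
Proof.
move=> eps0 eps1 M10 M20.
set theta := n.+1%:R + eps.
have theta0 : 0 < theta by rewrite ltr_wpDl.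
have [C1 C10 HC1] := inverse_expansion n eps0 eps1 (ltW M10) (ltW M20).
(* Since [|x - y| <= M1 * alpha] on [V], a vector of norm at most [c |x - y|] has an image under [B]
   of norm at most [alpha / 4], the margin between [V] and [W]. *)
pose c := (4 * M1 * M2)^-1.
have c0 : 0 < c by rewrite invr_gt0 !mulr_gt0.
have [K K0 HK] := @jet_remainder_bound R n.+1 c theta c0 theta0.
exists (C1 + K * C1); first by rewrite addr_ge0// mulr_ge0.
move=> E f J A B x0 alpha D V a0 a1 Al Bl BK Ab Bb Jl Jb JB fB fJ.
have B0 : B 0 = 0 by have := linear_subE 0 0 Bl; rewrite !subrr.
have AK v : v = A (B v) by rewrite BK.
have Dx0 : D x0 by rewrite /D subrr normr0.
have lower x y : D x -> D y -> (1 - 10^-1) * `|x - y| <= `|B (f x - f y)|.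
  by move=> Dx Dy; apply: perturbed_id_lower; exact: fB.
have q0 : (0 : R) <= 10^-1 by [].
have q1 : (10^-1 : R) < 1 by rewrite invf_lt1// ltr1n.
pose W y := `|B (y - f x0)| < 3 / 4 * alpha.
have VW y : V y -> W y by rewrite /V /W; move: a0; lra.
have /choice[g Wg] : forall y, exists x, W y -> D x /\ f x = y.
  move=> y; have [Wy|nWy] := pselect (W y); last by exists y.
  have [|||v va vE] := @perturbed_id_surj R E (fun v => B (f (x0 + v) - f x0))
    alpha 10^-1 (B (y - f x0)) q0 q1.
  - by rewrite addr0 subrr B0.
  - move=> v w va wa; rewrite -(linear_subE _ _ Bl) opprB addrA subrK.
    have vw : v - w = (x0 + v) - (x0 + w) by rewrite opprD addrACA subrr add0r.
    by rewrite {1 2}vw; apply: fB; rewrite /D addrC addKr.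
  (* The fixed point argument reaches [(1 - 1/10) * alpha], which exceeds [3/4 * alpha]. *)
  - apply: lt_le_trans Wy _; rewrite ler_wpM2r// ?(ltW a0)//; lra.
  exists (x0 + v) => _; split; first by rewrite /D addrC addKr.
  by have /(can_inj BK)/addIr := vE.
have /choice[p Hp] : forall y, exists p : seq E -> E,
  [/\ mlin p, perm_invariant p & W y ->
    [/\ p [::] = g y, forall s, (0 < size s <= n.+1)%N ->
       `|p s| <= C1 * \prod_(u <- s) `|u| &
     forall w, W (y + w) ->
      `|g (y + w) - \sum_(k < n.+2) (k`!%:R)^-1 *: p (nseq k w)|
        <= C1 * `|w| `^ theta]].
  move=> y; have [Wy|nWy] := pselect (W y); last first.
    (* Outside [W] the zero family keeps multilinearity and symmetry valid at every point. *)
    by exists (fun=> 0); split => // s1 s2 a u v; rewrite scaler0 addr0.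
  have [Dx fx] := Wg y Wy; set x := g y in Dx fx *.
  have Jxl : linear (fun u => J x [:: u]) by exact: (Jl x Dx [::] [::]).
  have [S [Sl SK Sb]] := perturbed_left_inverse q0 q1 Bl Jxl BK Bb
    (fun u => JB x u Dx).
  have {}Sb w : `|S w| <= 2 * M2 * `|w|.
    have := Sb w; rewrite -mulrA; set s := `|S w|.
    have : 0 <= s by exact: normr_ge0.
    set t := M2 * `|w|; lra.
  have [p [pl pp pb pE]] := HC1 E (J x) S (Jl x Dx) (Jb x Dx) Sl Sb SK.
  exists (set_nil x p); split.
  - exact: set_nil_mlin.
  - exact: set_nil_perm_invariant.
  move=> _; split => //.
    by move=> [|u s] // /andP[_ sn]; exact: pb.
  move=> w Wyw; rewrite big_ord_recl/= fact0 invr1 scale1r opprD addrA.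
  have [Dx' fx'] := Wg _ Wyw; set x' := g (y + w) in Dx' fx' *.
  apply: pE.
  (* Both points lie in [W], so [B w] has norm below [3/2 * alpha], hence below 2. *)
  - have -> : w = A (B (y + w - f x0) - B (y - f x0)).
      by rewrite -(linear_subE _ _ Bl) -AK opprB addrA subrK addrC addKr.
    apply: le_trans (Ab _) _; rewrite mulrC ler_wpM2r ?(ltW M10)//.
    apply: le_trans (ler_normB _ _) _.
    by move: Wyw Wy; rewrite /W; lra.
  - have := lower _ _ Dx' Dx; rewrite fx fx' (addrC y) addrK.
    have := Bb w; have : 0 <= `|x' - x| by exact: normr_ge0.
    by rewrite -mulrA; lra.
  - by have := fJ _ _ Dx' Dx; rewrite fx fx' (addrC y) addrK.
exists p; split.
- by move=> y /VW Wy; have [_ _ /(_ Wy)[-> _ _]] := Hp y; exact: Wg.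
- move=> x y Dx Dy fxy; apply/eqP; rewrite -subr_eq0 -normr_le0.
  have := lower _ _ Dx Dy; rewrite fxy subrr B0 normr0; lra.
- by move=> y; have [] := Hp y.
- move=> y s /VW Wy sn; have [_ _ /(_ Wy)[_ pb _]] := Hp y.
  apply: le_trans (pb s sn) _; rewrite ler_wpM2r ?prod_norm_ge0// lerDl.
  exact: mulr_ge0.
move=> x y s Vx Vy sn.
have [pxl pxp /(_ (VW _ Vx))[_ _ pxE]] := Hp x.
have [pyl pyp /(_ (VW _ Vy))[_ _ pyE]] := Hp y.
have := HK E E g p x y C1 C10 pxl pxp pyl pyp.
move=> /(_ _ s sn)/le_trans; apply; last first.
  apply: ler_wpM2r; first exact: prod_norm_ge0.
  by apply: ler_wpM2r; [exact: powR_ge0|rewrite lerDr].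
move=> w wz.
have Wxw : W (x + w).
  rewrite /W.
  have -> : B (x + w - f x0) = B (x - f x0) + B w.
    by have := Bl 1 (x - f x0) w; rewrite !scale1r addrAC.
  have zb : `|x - y| <= M1 * alpha.
    have -> : x - y = A (B (x - f x0) - B (y - f x0)).
      by rewrite -(linear_subE _ _ Bl) -AK opprB addrA subrK.
    apply: le_trans (Ab _) _; rewrite ler_wpM2l ?(ltW M10)//.
    apply: le_trans (ler_normB _ _) _.
    by move: Vx Vy; rewrite /V; lra.
  have : `|B w| <= alpha / 4.
    apply: le_trans (Bb w) _.
    have : M2 * `|w| <= M2 * (c * (M1 * alpha)).
      rewrite ler_wpM2l ?(ltW M20)//; apply: le_trans wz _.
      by rewrite ler_wpM2l ?(ltW c0).
    move=> /le_trans; apply; rewrite le_eqVlt; apply/orP; left; apply/eqP.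
    by rewrite /c; field; rewrite !gt_eqF.
  have := ler_normD (B (x - f x0)) (B w).
  by move: Vx; rewrite /V; lra.
split; first exact: pxE.
have -> : x + w = y + (w + (x - y)) by rewrite addrCA (addrC y) subrK addrC.
apply: pyE.
by rewrite addrCA (addrC y) subrK addrC.
Qed.

End InverseJet.

(** * Lipschitz jets *)

Section LipschitzBounds.
Context {R : realType}.

(** The cross-norm axiom peels off the last factor, down to the unit scalar of norm 1. *)
Lemma tensor_norm_pure {E : normedModType R} (N : forall k, tensor E k -> R)
    k (v : k.-tuple E) : tensor_norm N -> N k (tpure v) = \prod_(u <- v) `|u|.
Proof.
move=> HN; elim: k v => [|k IH] v.
  by rewrite (tuple0 v) (tn_scalar HN) big_nil.
have [v' [u vE]] : exists (v' : k.-tuple E) u, v = rcons_tuple v' u.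
  case: v => s; elim/last_ind: s => [//|s u _] sk.
  have sk' : size s == k by move: (sk); rewrite size_rcons.
  by exists (Tuple sk'), u; apply: val_inj.
rewrite vE -[tpure _]/(trcons (tpure v') u) (tn_cross HN) IH /=.
by rewrite -cats1 big_cat big_seq1.
Qed.

Lemma le_inf_mul (S : set R) (a b M : R) : S !=set0 -> 0 <= b ->
  (forall m, S m -> a <= m * b) -> inf S <= M -> a <= M * b.
Proof.
move=> S0 b0 H SM; have [bE|bn0] := eqVneq b 0.
  by have [m /H] := S0; rewrite bE !mulr0.
have {bn0}b0 : 0 < b by rewrite lt0r bn0.
rewrite -ler_pdivrMr//; apply: le_trans SM; apply: lb_le_inf => // m /H.
by rewrite ler_pdivrMr.
Qed.

(** The infimum is itself admissible, since every constraint is a closed inequality, affine in the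
    constant. *)
Lemma lip_bound_of_lip_norm {E F : normedModType R}
    (N : forall k, tensor E k -> R) n eps (U : set E) (f : jet E F) M :
  tensor_norm N -> lip N n eps U f -> lip_norm N n eps U f <= M ->
  lip_bound N n eps U f M.
Proof.
move=> HN [_ [M' HM']] H k kn x y Ux Uy v.
have N0 : 0 <= N k (tpure v) by rewrite tensor_norm_pure// prod_norm_ge0.
split; last rewrite -mulrA.
  by apply: le_inf_mul H => //; [exists M'|move=> m /(_ k kn x y Ux Uy v)[]].
apply: le_inf_mul H => //; first by exists M'.
  by rewrite mulr_ge0// powR_ge0.
by move=> m /(_ k kn x y Ux Uy v)[_]; rewrite mulrA.
Qed.

Lemma linear_bounded_is_clin {E F : normedModType R} (g : E -> F) M :
  linear g -> (forall u, `|g u| <= M * `|u|) -> g \in @is_clin R E F.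
Proof.
move=> gl gb; apply/asboolP; split => //.
pose G : {linear E -> F} := HB.pack g (GRing.isLinear.Build R E F *:%R g gl).
have : continuous G; last by [].
apply/linear_bounded_continuous/linear_boundedP.
exists (Num.max M 0); split; first exact: num_real.
move=> M' MM' x; apply: le_trans (gb x) _; rewrite ler_wpM2r//.
by apply: le_trans (ltW MM'); rewrite le_max lexx.
Qed.

Lemma clin_subsumE {E F : normedModType R} (f : clin E F) m (a : 'I_m -> R)
    (g : 'I_m -> clin E F) u :
  (f - \sum_(i < m) a i *: g i) u = f u - \sum_(i < m) a i *: g i u.
Proof.
rewrite -[LHS]/(f u - (\sum_(i < m) a i *: g i) u); congr (_ - _).
by elim/big_rec2: _ => // i y1 y2 _ <-.
Qed.

Lemma clin_linear {E F : normedModType R} (f : clin E F) : linear f.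
Proof. by have [] := clinP f. Qed.

(** Order 0 is set to zero because the almost Lipschitz condition does not bound the values of the
    map, and orders above [n + 1] because they are arbitrary; one constant then bounds every
    order. *)
Definition jet_tail {E F : normedModType R} n (f : jet E F) (x : E) :=
  jet_seq (fun k v => if (0 < k <= n.+1)%N then f k x v else 0).

Lemma jet_tailE {E F : normedModType R} n (f : jet E F) x k (v : k.-tuple E) :
  (0 < k <= n.+1)%N -> jet_tail n f x v = f k x v.
Proof. by move=> kn; rewrite /jet_tail jet_seqE kn. Qed.

End LipschitzBounds.

Section LipschitzJet.
Context {R : realType} {E : completeNormedModType R}.
Variables (N : forall k, tensor E k -> R) (n : nat) (eps M : R) (U : set E).
Variables (f : jet E E) (df : jet E (clin E E)).
Arguments f : clear implicits.
Arguments df : clear implicits.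
Hypotheses (HN : tensor_norm N) (eps0 : 0 < eps) (eps1 : eps <= 1) (M0 : 0 <= M).
Hypothesis fs : forall k, (k <= n.+1)%N -> forall x, U x -> sym_multilinear (f k x).
Hypothesis dfE : forall k, (k <= n)%N -> forall x, U x ->
  forall (v : k.-tuple E) (u : E), df k x v u = f k.+1 x [tuple of rcons v u].
Hypothesis dfM : lip_bound N n eps U df M.

Let J := jet_tail n f.

Lemma jet_tail_mlin x : U x -> mlin (J x).
Proof.
move=> Ux; apply: jet_seq_mlin => k.
case kn : (0 < k <= n.+1)%N; first by have [/andP[_ /fs]] := kn => /(_ x Ux)[].
by move=> v i c u w; rewrite scaler0 addr0.
Qed.

Lemma jet_tail_perm x s t : U x -> perm_eq s t -> J x s = J x t.
Proof.
move=> Ux st; apply: (jet_seq_perm_invariant _ st) => k p v.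
by case: ifP => [/andP[_ kn]|_] //; have [_ ->] := fs kn Ux.
Qed.

Lemma jet_tail_rcons x k (v : k.-tuple E) u : U x -> (k <= n)%N ->
  J x (rcons v u) = df k x v u.
Proof.
move=> Ux kn; rewrite dfE// -(@jet_tailE _ _ _ n)//.
Qed.

Lemma jet_tail1 x u : U x -> J x [:: u] = jet0 df x u.
Proof. by move=> Ux; rewrite -[[:: u]]/(rcons [tuple] u) jet_tail_rcons. Qed.

Lemma jet_tail_mbnd x : U x -> mbnd M (J x).
Proof.
move=> Ux; elim/last_ind => [|s u _].
  by rewrite /J /jet_tail /jet_seq/= normr0 mulr_ge0// prod_norm_ge0.
have [sn|sn] := leqP (size s) n; last first.
  rewrite /J /jet_tail /jet_seq ifF ?normr0; last first.
    by rewrite size_rcons/= ltnS leqNgt sn.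
  by rewrite mulr_ge0// prod_norm_ge0.
rewrite -[s]/(tval (in_tuple s)) jet_tail_rcons//=.
apply: le_trans (le_opnorm _ _) _.
rewrite -cats1 big_cat big_seq1 /= mulrA ler_wpM2r//.
have [] := dfM sn Ux Ux (in_tuple s).
by rewrite tensor_norm_pure.
Qed.

Lemma jet_tail_remainder1 x y u : U x -> U y ->
  `|J x [:: u] - \sum_(i < n.+1) (i`!%:R)^-1 *: J y (u :: nseq i (x - y))|
    <= M * `|x - y| `^ (n%:R + eps) * `|u|.
Proof.
move=> Ux Uy; have [_] := dfM (leq0n n) Ux Uy [tuple].
rewrite tensor_norm_pure// big_nil mulr1 subr0 => H.
apply: le_trans (ler_wpM2r (normr_ge0 u) H).
apply: le_trans (le_opnorm _ u).
rewrite /remainder clin_subsumE subn0 -jet_tail1//.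
rewrite le_eqVlt; apply/orP; left; apply/eqP; congr (`|_ - _|).
apply: eq_bigr => i _; congr (_ *: _).
rewrite -jet_tail_rcons//; last by rewrite add0n -ltnS.
(* [df] takes [u] as its last argument, whereas it comes first here. *)
by apply: jet_tail_perm; rewrite //= perm_sym perm_rcons.
Qed.

Lemma jet_tail_remainder0 x y :
  @remainder R E E n.+1 f 0 x y [tuple] = jet0 f x - jet0 f y -
    \sum_(i < n.+1) (i.+1`!%:R)^-1 *: J y (nseq i.+1 (x - y)).
Proof.
rewrite /remainder big_ord_recl fact0 invr1 scale1r opprD addrA.
congr (_ - _ - _).
  by congr (f _ _); apply: val_inj.
apply: eq_bigr => i _; congr (_ *: _).
have i1 : (0 < i.+1 <= n.+1)%N by rewrite ltnS ltn_ord.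
exact: esym (jet_tailE f y [tuple of [tuple] ++ nseq i.+1 (x - y)] i1).
Qed.

(** The [n] terms of positive degree and the remainder each contribute [M |x - y|^eps |u|]: all
    exponents are at least [eps] and the distance is at most 1. *)
Lemma jet_tail_near x y u : U x -> U y -> `|x - y| <= 1 ->
  `|J x [:: u] - J y [:: u]| <= n.+1%:R * M * `|x - y| `^ eps * `|u|.
Proof.
move=> Ux Uy xy; have := jet_tail_remainder1 u Ux Uy.
rewrite big_ord_recl/= fact0 invr1 scale1r.
set z := x - y in xy *; set T := \sum_(_ < _) _ => H.
have hp t : eps <= t -> `|z| `^ t <= `|z| `^ eps.
  move=> et; have := powR_le_powR (normr_ge0 z) xy eps0 et.
  by rewrite powR1 mul1r.
have -> : J x [:: u] - J y [:: u] = J x [:: u] - (J y [:: u] + T) + T.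
  by rewrite opprD addrA subrK.
apply: le_trans (ler_normD _ _) _; rewrite addrC -natr1 !mulrDl !mul1r.
apply: lerD; last first.
  apply: le_trans H _; rewrite ler_wpM2r// ler_wpM2l// hp// lerDr.
  by [].
apply: le_trans (ler_norm_sum _ _ _) _.
apply: le_trans (_ : _ <= \sum_(i < n) M * `|z| `^ eps * `|u|) _; last first.
  by rewrite sumr_const card_ord -[leLHS]mulr_natl !mulrA.
apply: ler_sum => i _; rewrite normrZ normfV normr_nat.
apply: le_trans (_ : _ <= 1 * (M * `|z| ^+ i.+1 * `|u|)) _.
  apply: ler_pM => //; rewrite ?invr_ge0//.
    by rewrite invf_le1 ?ltr0n ?fact_gt0// ler1n fact_gt0.
  apply: le_trans (jet_tail_mbnd Uy _) _.
  rewrite !big_cons prod_norm_nseq add0n exprS.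
  by rewrite le_eqVlt; apply/orP; left; apply/eqP; ring.
rewrite mul1r ler_wpM2r// ler_wpM2l// -powR_mulrn// hp//.
by apply: le_trans eps1 _; rewrite ler1n.
Qed.

End LipschitzJet.

(** * Almost Lipschitz jets from families of maps on lists *)

Section AlmostLipschitzOfSeq.
Context {R : realType}.

Lemma mlin_sym_multilinear {E F : lmodType R} k (p : seq E -> F) :
  mlin p -> perm_invariant p -> sym_multilinear (fun v : k.-tuple E => p v).
Proof.
move=> pl pp; split; first exact: mlin_multilinear.
by move=> s v; apply: pp; apply/tuple_permP; exists s.
Qed.

Lemma mlin_rcons_linear {E F : lmodType R} (p : seq E -> F) s :
  mlin p -> linear (fun u => p (rcons s u)).
Proof. by move=> pl c u v; rewrite -!cats1; exact: pl. Qed.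

(** The remainder of order [k] of the derivative, applied to [u], is the remainder of order [k + 1]
    of the map with the extra argument [u], so one family of estimates serves both. *)
Lemma almost_lip_of_seq {E : normedModType R} (N : forall k, tensor E k -> R)
    n eps C (V : set E) (p : E -> seq E -> E) :
  tensor_norm N -> 0 <= C ->
  (forall y, mlin (p y) /\ perm_invariant (p y)) ->
  (forall y s, V y -> (0 < size s <= n.+1)%N ->
     `|p y s| <= C * \prod_(u <- s) `|u|) ->
  (forall x y s, V x -> V y -> (size s <= n.+1)%N ->
    `|p x s - \sum_(i < (n.+1 - size s).+1)
        (i`!%:R)^-1 *: p y (s ++ nseq i (x - y))|
      <= C * `|x - y| `^ (n.+1%:R + eps - (size s)%:R)
           * \prod_(u <- s) `|u|) ->
  exists (psi : jet E E) (dpsi : jet E (clin E E)),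
    [/\ forall y, jet0 psi y = p y [::],
      almost_lip N n eps V psi dpsi & lip_bound N n eps V dpsi C].
Proof.
move=> HN C0 pP pb pR.
pose psi : jet E E := fun k y v => p y v.
pose g y (s : seq E) u := p y (rcons s u).
(* The default value [0] is never used on [V], where [g y v] is bounded. *)
pose dpsi : jet E (clin E E) := fun k y v => insubd (0 : clin E E) (g y v).
have gb y s u : V y -> (size s <= n)%N ->
    `|g y s u| <= C * \prod_(w <- s) `|w| * `|u|.
  move=> Vy sn; apply: le_trans (pb y _ Vy _) _; first by rewrite size_rcons.
  by rewrite -cats1 big_cat big_seq1 mulrA.
have dpsiE k y (v : k.-tuple E) u : V y -> (k <= n)%N ->
    dpsi k y v u = p y (rcons v u).
  move=> Vy kn; rewrite -[LHS]/(\val (insubd (0 : clin E E) (g y v)) u) insubdK//.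
  apply: (@linear_bounded_is_clin _ _ _ _ (C * \prod_(w <- v) `|w|)).
    by apply: mlin_rcons_linear; have [] := pP y.
  by move=> w; apply: gb => //; rewrite size_tuple.
have dpsiB : lip_bound N n eps V dpsi C.
  move=> k kn x y Vx Vy v; rewrite tensor_norm_pure//; split.
    apply: opnorm_le; first by rewrite mulr_ge0 ?prod_norm_ge0.
    by move=> u; rewrite dpsiE// gb// size_tuple.
  apply: opnorm_le.
    by rewrite !mulr_ge0 ?prod_norm_ge0 ?powR_ge0.
  move=> u; rewrite /remainder clin_subsumE dpsiE//.
  have := pR x y (rcons v u) Vx Vy; rewrite size_rcons size_tuple subSS ltnS.
  move=> /(_ kn) H; rewrite -cats1 big_cat big_seq1 /= cats1 mulrA in H.
  have e : n.+1%:R + eps - k.+1%:R = n%:R + eps - k%:R :> R.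
    by rewrite -!natr1; ring.
  rewrite e in H; apply: le_trans H; rewrite le_eqVlt; apply/orP; left; apply/eqP.
  congr (`|_ - _|); apply: eq_bigr => i _; congr (_ *: _).
  rewrite dpsiE//=; last by have := ltn_ord i; lia.
  by have [_ pp] := pP y; apply: pp; rewrite -!cats1 -!catA perm_cat2l perm_catC.
exists psi, dpsi; split => //.
(* The order 0 estimate holds at all distances. *)
exists +oo%E => //; split.
- by move=> k _ x _; have [pl pp] := pP x; exact: mlin_sym_multilinear.
- by move=> k kn x Vx v u; rewrite dpsiE.
- split; last by exists C.
  move=> k kn x Vx; have [pl pp] := pP x; split.
    move=> v i c u w; apply: val_inj; apply/funext => z.
    rewrite -[LHS]/(dpsi k x (tset v i (c *: u + w)) z).
    rewrite -[RHS]/(c *: dpsi k x (tset v i u) z + dpsi k x (tset v i w) z).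
    by rewrite !dpsiE// !tset_cat !rcons_cat; exact: pl.
  move=> s v; apply: val_inj; apply/funext => z.
  rewrite -[LHS]/(dpsi k x (tperm_act s v) z) -[RHS]/(dpsi k x v z) !dpsiE//.
  apply: pp; rewrite -!cats1 perm_cat2r.
  by apply/tuple_permP; exists s.
- exists C => // x y Vx Vy _.
  have := pR x y [::] Vx Vy isT; rewrite big_nil mulr1 subr0.
  by rewrite /remainder.
Qed.

End AlmostLipschitzOfSeq.

(** * The inverse function theorem *)

Theorem theorem3p7 (R : realType) (gamma : R) (hgamma : 1 < gamma)
    (n : nat) (eps : R) (heps0 : 0 < eps) (heps1 : eps <= 1)
    (hdeg : gamma = n.+1%:R + eps) :
  exists (delta : R -> R) (C : R -> R -> R),
    (forall p, 0 < p -> 0 < delta p) /\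
    forall (E : completeNormedModType R) (N : forall k, tensor E k -> R)
      (r : R) (x0 : E) (phi : jet E E) (dphi : jet E (clin E E))
      (inv_dphi : clin E E) (M1 M2 : R),
      tensor_norm N ->
      0 < r ->
      almost_lip N n eps (ball x0 r) phi dphi ->
      cancel (jet0 dphi x0) inv_dphi -> cancel inv_dphi (jet0 dphi x0) ->
      0 < M1 -> 0 < M2 ->
      lip_norm N n eps (ball x0 r) dphi <= M1 ->
      `|inv_dphi| <= M2 ->
      forall alpha : R, alpha < r -> 0 < alpha -> alpha <= delta (M1 * M2) ->
      let V0 := [set jet0 phi x0 + jet0 dphi x0 v | v in ball 0 (alpha / 2)] in
      let U0 := ball x0 alpha `&` jet0 phi @^-1` V0 in
      (exists (psi : jet E E) (dpsi : jet E (clin E E)),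
         almost_lip_diffeo N n eps U0 V0 phi dphi psi dpsi /\
         lip_norm N n eps V0 dpsi <= C M1 M2) /\
      ball x0 (alpha / 3) `<=` U0.
Proof.
(* [C] is selected for all pairs of bounds before the space is known, with default 0 when a bound is
   not positive. *)
have /choice[C HC] : forall M : R * R, exists C : R,
    0 < M.1 -> 0 < M.2 -> 0 <= C /\ inverse_jet_bound n eps M.1 M.2 C.
  move=> [M1 M2]; have [M10|M10] := ltP 0 M1; last by exists 0.
  have [M20|M20] := ltP 0 M2; last by exists 0.
  by have [C C0 HC] := inverse_jet n heps0 heps1 M10 M20; exists C.
(* Chosen so that [M2 |dphi x - dphi x0| <= 1/10] on [B(x0, delta (M1 M2))]. *)
pose delta (p : R) : R := Num.min 1 ((10 * n.+1%:R * p)^-1 `^ eps^-1).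
exists delta, (fun M1 M2 => C (M1, M2)); split.
  move=> p p0; rewrite lt_min ltr01 powR_gt0// invr_gt0.
  by rewrite mulr_gt0// mulr_gt0.
move=> E N r x0 phi dphi B M1 M2 HN r0 [dl dl0 [phis dphiE dphil phi0]] AK BK.
move=> M10 M20 dphiM BM al alr al0 ald V0 U0.
have M1' : 0 <= M1 by exact: ltW.
have {}dphiM := lip_bound_of_lip_norm HN dphil dphiM.
have [C0 {}HC] := HC (M1, M2) M10 M20.
have [al1 ale] : al <= 1 /\ 10 * n.+1%:R * (M1 * M2) * al `^ eps <= 1.
  move: ald; rewrite le_min => /andP[? ald]; split => //.
  have p0 : 0 < 10 * n.+1%:R * (M1 * M2) by rewrite !mulr_gt0.
  rewrite mulrC -ler_pdivlMr// mul1r.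
  apply: le_trans (_ : _ <= (10 * n.+1%:R * (M1 * M2))^-1 `^ eps^-1 `^ eps) _.
    by apply: ge0_ler_powR => //; rewrite ?nnegrE ?powR_ge0 ?(ltW al0) ?(ltW heps0).
  by rewrite -powRrM mulVf ?gt_eqF// powRr1// invr_ge0 ltW.
have ballP c x : ball x0 c x <-> `|x - x0| < c.
  by rewrite -ball_normE /ball_/= distrC.
pose A : clin E E := jet0 dphi x0.
pose J := jet_tail n phi.
pose D x := `|x - x0| < al.
have Ur x : D x -> ball x0 r x by move=> Dx; apply/ballP; exact: lt_trans alr.
have Ux0 : ball x0 r x0 by apply/ballP; rewrite subrr normr0.
have conv c x y t : `|x - x0| < c -> `|y - x0| < c -> 0 <= t -> t <= 1 ->
    `|y + t *: (x - y) - x0| < c.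
  move=> xc yc t0 t1.
  have -> : y + t *: (x - y) - x0 = t *: (x - x0) + (1 - t) *: (y - x0).
    rewrite scalerBl scale1r addrCA -scalerBr opprB addrA subrK.
    by rewrite addrAC addrC.
  apply: le_lt_trans (ler_normD _ _) _; rewrite !normrZ !ger0_norm ?subr_ge0//.
  have [tE|tn] := eqVneq t 0; first by rewrite tE mul0r add0r subr0 mul1r.
  have : t * `|x - x0| < t * c by rewrite ltr_pM2l// lt0r tn.
  have : (1 - t) * `|y - x0| <= (1 - t) * c.
    by rewrite ler_wpM2l ?subr_ge0// ltW.
  lra.
have Jl x : ball x0 r x -> mlin (J x) by exact: jet_tail_mlin.
have Jb x : ball x0 r x -> mbnd M1 (J x) by exact: jet_tail_mbnd HN M1' dphiE dphiM x.
have convr x y t : ball x0 r x -> ball x0 r y -> 0 <= t -> t <= 1 ->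
    ball x0 r (y + t *: (x - y)).
  by move=> /ballP ? /ballP ? ? ?; apply/ballP; exact: conv.
have J1 := @jet_tail_remainder1 R E N n eps M1 _ phi dphi HN phis dphiE dphiM.
have f0 : exists2 Mt : R, 0 <= Mt & exists2 d : R, 0 < d &
  forall x y, ball x0 r x -> ball x0 r y -> `|x - y| < d ->
  `|jet0 phi x - jet0 phi y -
     \sum_(i < n.+1) (i.+1`!%:R)^-1 *: J y (nseq i.+1 (x - y))|
    <= Mt * `|x - y| `^ (n.+1%:R + eps).
  have [Mt Mt0 HMt] := phi0; exists Mt => //.
  (* A finite scale is extracted from [dl], which may be infinite. *)
  have [d d0 Hd] : exists2 d : R, 0 < d & forall t : R, t < d -> (t%:E < dl)%E.
    case: dl dl0 {HMt phi0} => [d|_|//]; last by exists 1 => // t _; rewrite ltry.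
    by rewrite lte_fin => d0; exists d => // t td; rewrite lte_fin.
  exists d => // x y Ux Uy xy.
  by rewrite -jet_tail_remainder0; apply: HMt => //; exact: Hd.
have Rem := taylor_remainder_le heps0 heps1 M1' convr Jl Jb J1 f0.
have Al : linear A by exact: clin_linear.
have Bl : linear B by exact: clin_linear.
have Bb v : `|B v| <= M2 * `|v|.
  by apply: le_trans (le_opnorm _ _) _; rewrite ler_wpM2r.
have Ab v : `|A v| <= M1 * `|v|.
  rewrite -(@jet_tail1 _ _ n _ phi dphi dphiE)//.
  by have := Jb x0 Ux0 [:: v]; rewrite big_seq1.
(* Bounds [dphi x - dphi x0] on the ball of radius [al]; the choice of [delta] gives
   [M2 * q <= 1/10]. *)
pose q := n.+1%:R * M1 * al `^ eps.
have JA x u : D x -> `|J x [:: u] - A u| <= q * `|u|.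
  move=> Dx; rewrite -(@jet_tail1 _ _ n _ phi dphi dphiE)//.
  apply: le_trans (jet_tail_near HN heps0 heps1 M1' phis dphiE dphiM u (Ur _ Dx) Ux0 _) _.
    by apply: ltW; apply: lt_le_trans al1.
  rewrite ler_wpM2r// ler_wpM2l ?mulr_ge0//.
  by apply: ge0_ler_powR; rewrite ?nnegrE ?(ltW heps0) ?(ltW al0) ?(ltW Dx).
have fA x y : D x -> D y ->
    `|jet0 phi x - jet0 phi y - A (x - y)| <= q * `|x - y|.
  exact: (norm_diff_linear_le heps0 heps1 M1' Jl Jb f0 (D' := D) Ur Al
    (fun x y t => @conv al x y t) JA).
have qM2 t : 0 <= t -> M2 * (q * t) <= 10^-1 * t.
  move=> t0; rewrite mulrA ler_wpM2r//.
  by move: ale; rewrite /q; set X := al `^ eps; set k := n.+1%:R; nra.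
have JB x u : D x -> `|B (J x [:: u]) - u| <= 10^-1 * `|u|.
  move=> Dx; rewrite -{2}(AK u) -(linear_subE _ _ Bl).
  apply: le_trans (Bb _) _; apply: le_trans (qM2 _ _) => //.
  by rewrite ler_wpM2l ?(ltW M20)// JA.
have fB x y : D x -> D y ->
    `|B (jet0 phi x - jet0 phi y) - (x - y)| <= 10^-1 * `|x - y|.
  move=> Dx Dy; rewrite -{1}(AK (x - y)) -(linear_subE _ _ Bl).
  apply: le_trans (Bb _) _; apply: le_trans (qM2 _ _) => //.
  by rewrite ler_wpM2l ?(ltW M20)// fA.
have [p [pD pinj pP pb pR]] := HC E (jet0 phi) J A B x0 al al0 al1 Al Bl BK Ab Bb
  (fun x Dx => Jl x (Ur x Dx)) (fun x Dx => Jb x (Ur x Dx)) JB fB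
  (fun x y Dx Dy => Rem x y (Ur x Dx) (Ur y Dy)).
have VE y : V0 y <-> `|B (y - jet0 phi x0)| < al / 2.
  split=> [[v vb <-]|By].
    by rewrite addrC addKr AK; move: vb; rewrite -ball_normE /ball_/= sub0r normrN.
  exists (B (y - jet0 phi x0)); last by rewrite BK addrC subrK.
  by rewrite -ball_normE /ball_/= sub0r normrN.
have [psi [dpsi [psi0 psilip psiC]]] := @almost_lip_of_seq _ _ N n eps _ V0 p HN C0 pP
  (fun y s Vy => pb y s ((VE y).1 Vy))
  (fun x y s Vx Vy => pR x y s ((VE x).1 Vx) ((VE y).1 Vy)).
have pV y : V0 y -> D (p y [::]) /\ jet0 phi (p y [::]) = y.
  by move=> /VE; exact: pD.
have Dx0 : D x0 by rewrite /D subrr normr0.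
split; last first.
  move=> x /ballP xa; have Dx : D x by apply: lt_trans xa _; move: al0; lra.
  split; first by apply/ballP.
  (* Read through [B], [phi] stretches distances to [x0] by at most [11/10], and [11/30 < 1/2]. *)
  apply/VE; have := fB x x0 Dx Dx0.
  have := ler_normD (B (jet0 phi x - jet0 phi x0) - (x - x0)) (x - x0).
  by rewrite subrK; move: xa; move: al0; lra.
exists psi, dpsi; split; last first.
  (* A point of [V0] forces admissible constants to be nonnegative, so their infimum is at most each
     of them. *)
  have Vx0 : V0 (jet0 phi x0).
    by apply/VE; rewrite subrr -(subrr 0) (linear_subE _ _ Bl) subrr normr0 divr_gt0.
  apply: ge_inf => //; exists 0 => m /(_ 0%N isT _ _ Vx0 Vx0 [tuple])[+ _].
  by rewrite tensor_norm_pure// big_nil mulr1; exact: le_trans.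
split => //.
- split.
  + by move=> x [].
  + move=> x y /set_mem[/ballP Dx _] /set_mem[/ballP Dy _]; exact: pinj.
  + move=> y Vy; have [Dp pE] := pV y Vy; exists (p y [::]) => //.
    by split; [exact/ballP|rewrite /= pE].
- move=> x [/ballP Dx Vx]; rewrite psi0; have [Dp pE] := pV _ Vx.
  exact: pinj.
- exists dl => //; split.
  + by move=> k kn x [/ballP Dx _]; apply: phis => //; exact: Ur.
  + by move=> k kn x [/ballP Dx _]; apply: dphiE => //; exact: Ur.
  + split; first by move=> k kn x [/ballP Dx _]; apply: dphil.1 => //; exact: Ur.
    exists M1 => k kn x y [/ballP Dx _] [/ballP Dy _].
    by apply: dphiM => //; exact: Ur.
  + have [Mt Mt0 H] := phi0; exists Mt => // x y [/ballP Dx _] [/ballP Dy _].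
    by apply: H; exact: Ur.
Qed.
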